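(* Let $\mathbb{P},\mathbb{Q}$ be the source and target distributions on $\mathbb{X}\times\mathbb{R}$ and $\mathcal{F}$ a class of functions $\mathbb{X}\to\mathbb{R}$, and assume: (1) $\mathbb{E}_{\mathbb{P}}[Y\mid X=x]=\mathbb{E}_{\mathbb{Q}}[Y\mid X=x]=:f^*(x)$ for every $x\in\mathbb{X}$; (2) $f^*\in\mathcal{F}$; (3) $\sup\{\|f\|_\infty: f\in\mathcal{F}\}\le 1$ and $|Y|\le 1$ almost surely under both $\mathbb{P}$ and $\mathbb{Q}$; (4) the given pilot estimates $\hat\rho:\mathbb{X}\to\mathbb{R}_+$ and $\hat f_0:\mathbb{X}\to\mathbb{R}$ satisfy $\|\hat\rho\|_\infty\le C_{\mathsf{dr}}<+\infty$ and $\|\hat f_0\|_\infty\le C_{\mathsf{rf}}<+\infty$ for constants $C_{\mathsf{dr}},C_{\mathsf{rf}}\in(0,+\infty)$. Let $\hat f_{\mathsf{DR}}\in\operatorname{argmin}\{\widehat{\mathcal{R}}_{\mathsf{DR}}(f): f\in\mathcal{F}\}$ be the doubly-robust estimator. Then for every $\delta\in(0,1)$, with probability at least $1-\delta$ under $\mathbb{P}^{\otimes n_{\mathbb{P}}}\otimes\mathbb{Q}_X^{\otimes n_{\mathbb{Q}}}$, $$ \begin{aligned} \mathcal{E}_{\mathbb{Q}}(\hat f_{\mathsf{DR}}) =\ & \mathbb{E}_{X\sim\mathbb{Q}_X}\left[\{\hat f_{\mathsf{DR}}(X)-f^*(X)\}^2\right]\\ \le\ & 4\,\|\hat\rho-\rho^*\|_{L^2(\mathbb{X},\mathbb{P}_X)}\cdot\|\hat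 f_0-f^*\|_{L^2(\mathbb{X},\mathbb{P}_X)} +12(2+C_{\mathsf{rf}})\log\left(\tfrac{3}{\delta}\right)\left(\frac{C_{\mathsf{dr}}}{n_{\mathbb{P}}}+\frac{1}{n_{\mathbb{Q}}}\right)\\ &+4(1+C_{\mathsf{dr}})(2+C_{\mathsf{rf}})\sqrt{2\log\left(\tfrac{3}{\delta}\right)}\left(\frac{1}{\sqrt{n_{\mathbb{P}}}}+\frac{1}{\sqrt{n_{\mathbb{Q}}}}\right)\\ &+8(1+C_{\mathsf{dr}})(2+C_{\mathsf{rf}})\sqrt{\log\left(\tfrac{3}{\delta}\right)}\left(\frac{\mathcal{R}_{n_{\mathbb{P}}}^{\mathbb{P}_X}(\mathcal{F}^* )}{\sqrt{n_{\mathbb{P}}}}+\frac{\mathcal{R}_{n_{\mathbb{Q}}}^{\mathbb{Q}_X}(\mathcal{F}^* )}{\sqrt{n_{\mathbb{Q}}}}\right)\\ &+8C_{\mathsf{dr}}(1+C_{\mathsf{rf}})\,\mathcal{R}_{n_{\mathbb{P}}}^{\mathbb{P}_X}(\mathcal{F}^* )+8(3+C_{\mathsf{rf}})\,\mathcal{R}_{n_{\mathbb{Q}}}^{\mathbb{Q}_X}(\mathcal{F}^* ). \end{aligned} $$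
   Context: $\mathbb{X}$ is the covariate space; $\Delta(S)$ denotes the set of probability measures on $S$; $\mathbb{R}_+=[0,\infty)$. $\mathbb{P},\mathbb{Q}\in\Delta(\mathbb{X}\times\mathbb{R})$ have $X$-marginals $\mathbb{P}_X,\mathbb{Q}_X$, absolutely continuous with respect to a $\sigma$-finite measure $\mu_{\mathbb{X}}$ on $\mathbb{X}$ with densities $p_X,q_X$; the covariate density ratio is $\rho^*(x):=q_X(x)/p_X(x)$, assumed finite everywhere. Data: labeled source samples $(X_i^{\mathbb{P}},Y_i^{\mathbb{P}})_{i=1}^{n_{\mathbb{P}}}\sim\mathbb{P}^{\otimes n_{\mathbb{P}}}$ and, independently, unlabeled target covariates $(X_j^{\mathbb{Q}})_{j=1}^{n_{\mathbb{Q}}}\sim\mathbb{Q}_X^{\otimes n_{\mathbb{Q}}}$. The pilot estimates $\hat\rho,\hat f_0$ (of $\rho^*$ and $f^*$) are given fixed functions (not depending on these data). Risk: $\mathcal{R}_{\mathbb{Q}}(f):=\mathbb{E}_{(X,Y)\sim\mathbb{Q}}[\{Y-f(X)\}^2]$; excess risk $\mathcal{E}_{\mathbb{Q}}(f):=\mathcal{R}_{\mathbb{Q}}(f)-\min_{g\in\mathcal{F}}\mathcal{R}_{\mathbb{Q}}(g)$. DR empirical risk: for $f\in\mathcal{F}$, $$\widehat{\mathcal{R}}_{\mathsf{DR}}(f):=\frac{1}{n_{\mathbb{P}}}\sum_{i=1}^{n_{\mathbb{P}}}\hat\rho(X_i^{\mathbb{P}})\left[\{Y_i^{\mathbb{P}}-f(X_i^{\mathbb{P}})\}^2-\{\hat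 f_0(X_i^{\mathbb{P}})-f(X_i^{\mathbb{P}})\}^2\right]+\frac{1}{n_{\mathbb{Q}}}\sum_{j=1}^{n_{\mathbb{Q}}}\{\hat f_0(X_j^{\mathbb{Q}})-f(X_j^{\mathbb{Q}})\}^2.$$ Shifted class: $\mathcal{F}^*:=\{f-f^*: f\in\mathcal{F}\}$. Rademacher complexity of a class $\mathcal{G}$ of functions $\mathbb{X}\to\mathbb{R}$ with respect to $\mu\in\Delta(\mathbb{X})$: $$\mathcal{R}_n^{\mu}(\mathcal{G}):=\mathbb{E}\left[\sup_{g\in\mathcal{G}}\left|\frac1n\sum_{i=1}^n\sigma_i g(X_i)\right|\right],$$ with $(X_1,\dots,X_n)\sim\mu^{\otimes n}$ and independent $(\sigma_1,\dots,\sigma_n)$ uniform on $\{\pm1\}^n$. *)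

(* Defs.v *)
From HB Require Import structures.
From mathcomp Require Export all_boot all_order all_algebra.
From mathcomp Require Export all_classical all_reals all_analysis.
(* Not exported by all_analysis; provides the measurable structure of \bar R. *)
From mathcomp Require Export measurable_realfun.
Export Order.TTheory GRing.Theory Num.Theory.
Export numFieldNormedType.Exports.

Set Implicit Arguments.
Unset Strict Implicit.
Unset Printing Implicit Defensive.

#[global] Open Scope classical_set_scope.
#[global] Open Scope ring_scope.

Section iid.
Context (d : measure_display) (T : measurableType d) (R : realType).

Definition cons_pair (n : nat) (z : T * n.-tuple T) : n.+1.-tuple T :=
  [the n.+1.-tuple T of z.1 :: z.2].

Lemma measurable_cons_pair n : measurable_fun [set: T * n.-tuple T] (@cons_pair n).
Proof. exact: measurable_cons measurable_fst measurable_snd. Qed.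

HB.instance Definition _ n := isMeasurableFun.Build _ _ _ _ (@cons_pair n)
  (@measurable_cons_pair n).

(* The n-fold product measure $\mu^{\otimes n}$ on the product sigma-algebra of
   [n.-tuple T]; it is determined by its values on boxes, see [iid_law_box]. *)
Fixpoint iid_law (mu : probability T R) (n : nat) : probability (n.-tuple T) R :=
  if n is m.+1 then distribution (mu \x iid_law mu m)%E (@cons_pair m)
  else \d_([tuple] : 0.-tuple T).

Lemma iid_law_box (mu : probability T R) n (A : 'I_n -> set T) :
  (forall i, measurable (A i)) ->
  iid_law mu n [set x | forall i, A i (tnth x i)] = (\prod_(i < n) mu (A i))%E.
Proof.
elim: n A => [|n ih] A mA.
  by rewrite big_ord0 /= diracE mem_set//= => -[].
rewrite big_ord_recl -(ih (A \o lift ord0)); last by move=> i; exact: mA.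
have mB : measurable [set x : n.-tuple T | forall i, A (lift ord0 i) (tnth x i)].
  rewrite (_ : [set _ | _] = \big[setI/setT]_(i < n)
      ((fun x => tnth x i) @^-1` A (lift ord0 i))).
    apply: bigsetI_measurable => i _; rewrite -[X in measurable X]setTI.
    exact: (measurable_tnth i).
  rewrite -bigcap_seq; apply/seteqP; split=> [x xA i _|x xA i]; first exact: xA.
  by apply: xA; rewrite /= mem_index_enum.
rewrite -product_measure1E//= /distribution /pushforward.
congr ((_ \x _)%E _); apply/seteqP; split=> -[x y] /=.
- by move=> H; split=> [|i]; [exact: (H ord0)|have := H (lift ord0 i); rewrite tnthS].
- move=> [H0 H] i; case: (unliftP ord0 i) => [j ->|->]; last exact: H0.
  by rewrite tnthS; exact: H.
Qed.

End iid.

Section outer.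
Context (d : measure_display) (T : measurableType d) (R : realType).
Local Open Scope ereal_scope.

(* Suprema over an uncountable class need not be measurable.  Expectations of
   such suprema are outer expectations; they are the usual expectations whenever
   the integrand is measurable, see [outer_expectationE].  To be used with
   nonnegative [Z] only. *)
Definition outer_expectation (mu : probability T R) (Z : T -> \bar R) : \bar R :=
  ereal_inf [set \int[mu]_x U x | U in
    [set U : T -> \bar R | measurable_fun [set: T] U /\ forall x, Z x <= U x]].

Lemma outer_expectationE (mu : probability T R) (Z : T -> \bar R) :
  measurable_fun [set: T] Z -> (forall x, 0 <= Z x) ->
  outer_expectation mu Z = \int[mu]_x Z x.
Proof.
move=> mZ Z0; apply/le_anti/andP; split.
  by apply: ereal_inf_lbound; exists Z.
apply: le_ereal_inf_tmp => _ [U [mU ZU] <-].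
by apply: ge0_le_integral => //= x _; exact: le_trans (Z0 x) (ZU x).
Qed.

(* "With probability at least [p]": [S] itself need not be measurable. *)
Definition with_prob_ge (mu : probability T R) (p : R) (S : set T) :=
  exists A : set T, [/\ measurable A, A `<=` S & p%:E <= mu A].

End outer.

Section regression.
Context (d : measure_display) (X : measurableType d) (R : realType).
Local Open Scope ereal_scope.
Implicit Types (P Q : probability (X * R)%type R) (f g : X -> R).

Definition proj_cov : X * R -> X := fst.

Lemma measurable_proj_cov : measurable_fun [set: X * R] proj_cov.
Proof. exact: measurable_fst. Qed.

HB.instance Definition _ := isMeasurableFun.Build _ _ _ _ proj_cov
  measurable_proj_cov.

Definition cov_law P : probability X R := distribution P proj_cov.

(* [f] is a version of $x \mapsto E_P[Y | X = x]$. *)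
Definition is_regression P f :=
  [/\ P.-integrable setT (fun z => z.2%:E),
      (cov_law P).-integrable setT (EFin \o f) &
      forall B : set X, measurable B ->
        \int[P]_(z in proj_cov @^-1` B) z.2%:E = \int[cov_law P]_(x in B) (f x)%:E].

Definition has_density (mu : {measure set X -> \bar R}) (nu : probability X R)
    (p : X -> R) :=
  [/\ measurable_fun [set: X] p, forall x, (0 <= p x)%R &
      forall B, measurable B -> nu B = \int[mu]_(x in B) (p x)%:E].

(* [0 / 0] is read as [0]; [q x / p x] with [p x = 0 < q x] is a junk value that
   has to be excluded by hypothesis. *)
Definition density_ratio (p q : X -> R) : X -> R := fun x => (q x / p x)%R.

Definition sup_norm f : \bar R := ereal_sup [set `|f x|%:E | x in setT].

Definition L2norm (nu : probability X R) f : \bar R := 'N[nu]_2%:E [EFin \o f].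

Definition risk Q f : \bar R := 'E_Q[fun z : X * R => ((z.2 - f z.1) ^+ 2)%R].

(* [ereal_inf] is the minimum over [F] when it is attained, as it is at the
   regression function if that belongs to [F]. *)
Definition excess_risk Q (F : set (X -> R)) f : \bar R :=
  risk Q f - ereal_inf [set risk Q g | g in F].

Definition shifted_class (F : set (X -> R)) (f0 : X -> R) : set (X -> R) :=
  [set (fun x => f x - f0 x)%R | f in F].

(* The sign $\sigma_i$ is [(-1) ^+ s i].  As the signs range over a finite set, the
   outer expectation for the joint law of sample and signs is the average over the
   signs of the outer expectations over the sample. *)
Definition rademacher (mu : probability X R) (n : nat) (G : set (X -> R)) : \bar R :=
  ((2 ^+ n)^-1)%:E * \sum_(s : {ffun 'I_n -> bool})
    outer_expectation (iid_law mu n) (fun x : n.-tuple X =>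
      ereal_sup [set `|n%:R^-1 * \sum_(i < n) (-1) ^+ s i * g (tnth x i)|%R%:E
                | g in G]).

End regression.

Section doubly_robust.
Context (d : measure_display) (X : measurableType d) (R : realType).
Variables (nP nQ : nat).

Definition dr_risk (rhohat fhat0 : X -> R) (D : nP.-tuple (X * R) * nQ.-tuple X)
    (f : X -> R) : R :=
  nP%:R^-1 * (\sum_(i < nP) let: (x, y) := tnth D.1 i in
     rhohat x * ((y - f x) ^+ 2 - (fhat0 x - f x) ^+ 2)) +
  nQ%:R^-1 * (\sum_(j < nQ) (fhat0 (tnth D.2 j) - f (tnth D.2 j)) ^+ 2).

Definition data_law (P Q : probability (X * R)%type R) :
    probability (nP.-tuple (X * R) * nQ.-tuple X)%type R :=
  (iid_law P nP \x iid_law (cov_law Q) nQ)%E.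

End doubly_robust.

Definition is_argmin (T : Type) (R : realType) (F : set T) (J : T -> R) (f : T) :=
  F f /\ forall g, F g -> J f <= J g.

(* Main.v *)
(** Write [g = fDR - fstar].  Since [fDR] minimises the empirical risk, and since
    the quadratic parts in the pilot [fhat0] cancel, the empirical averages of the
    losses [-2 rhohat (Y - fhat0) g] and [g^2 + 2 g (fstar - fhat0)] have a
    nonpositive sum; the population version of that sum is [E_Q g^2] plus a bias
    term, bounded by the product of the two pilot errors (Hoelder).  The excess risk
    is thus at most this bias plus two suprema of empirical processes, handled by
    McDiarmid's inequality, symmetrisation and contraction.

    The class is uncountable and its suprema need not be measurable, so every
    supremum is replaced by a measurable majorant of the family.  Symmetrisation and
    contraction are performed on majorants.  A majorant of a family with bounded
    differences does not itself have bounded differences; McDiarmid's induction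
    repairs this one coordinate at a time, by cutting the majorant off at its
    essential infimum along that coordinate plus the admissible oscillation. *)

From HB Require Import structures.
Require Import Defs.
From mathcomp Require Import ess_sup_inf ring lra.

Set Implicit Arguments.
Unset Strict Implicit.
Unset Printing Implicit Defensive.

(** * Bounded measurable functions and their integrals *)

(** Three points shape the bookkeeping. An outer expectation is an infimum that need not be
    attained, so a majorant nearly achieving a Rademacher complexity is available only up to a
    positive slack. For each of the two empirical processes this slack is half of the
    [log (3 / delta)] term of order [1 / n], so that term pays for non-attainment, while the
    square-root terms come from McDiarmid's inequality, with failure probability [delta / 3] per
    sample. Symmetrisation costs a factor 2 and contraction of one-sided signed sums costs only the
    Lipschitz constant, namely [2 * Cdr * (1 + Crf)] for the source loss and [2 * (3 + Crf)] for the
    target loss. Finally, the density ratio may be unbounded and even outside L2: it never enters an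
    empirical process, only population integrals, where it is integrable because the target law has
    mass one. *)

Section bounded_measurable.
Context (R : realType).

(** A bound valid everywhere makes such functions integrable for every probability measure and
    stable under sections, so integrals can be handled as real numbers. *)
Definition bmeas d (T : measurableType d) (f : T -> R) :=
  measurable_fun [set: T] f /\ exists M, forall x, `|f x| <= M.

Lemma bmeas_cst d (T : measurableType d) (a : R) : bmeas (fun _ : T => a).
Proof. by split; [exact: measurable_cst|exists `|a|]. Qed.

Lemma bmeasD d (T : measurableType d) (f g : T -> R) :
  bmeas f -> bmeas g -> bmeas (fun x => f x + g x).
Proof.
move=> [mf [M fM]] [mg [N gN]]; split; first exact: measurable_funD.
by exists (M + N) => x; rewrite (le_trans (ler_normD _ _))// lerD.
Qed.

Lemma bmeasM d (T : measurableType d) (f g : T -> R) :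
  bmeas f -> bmeas g -> bmeas (fun x => f x * g x).
Proof.
move=> [mf [M fM]] [mg [N gN]]; split; first exact: measurable_funM.
by exists (M * N) => x; rewrite normrM ler_pM.
Qed.

Lemma bmeasZ d (T : measurableType d) (a : R) (f : T -> R) :
  bmeas f -> bmeas (fun x => a * f x).
Proof. by move=> bf; apply: bmeasM => //; exact: bmeas_cst. Qed.

Lemma bmeasN d (T : measurableType d) (f : T -> R) :
  bmeas f -> bmeas (fun x => - f x).
Proof.
by move=> [mf [M fM]]; split; [exact: measurable_funN|exists M => x; rewrite normrN].
Qed.

Lemma bmeasB d (T : measurableType d) (f g : T -> R) :
  bmeas f -> bmeas g -> bmeas (fun x => f x - g x).
Proof. by move=> bf bg; apply: bmeasD => //; exact: bmeasN. Qed.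

Lemma bmeas_sum d (T : measurableType d) (I : Type) (r : seq I)
    (f : I -> T -> R) :
  (forall i, bmeas (f i)) -> bmeas (fun x => \sum_(i <- r) f i x).
Proof.
move=> bf; elim: r => [|i r ih].
  rewrite (_ : (fun _ => _) = cst 0); first exact: bmeas_cst.
  by apply/funext => x; rewrite big_nil.
rewrite (_ : (fun _ => _) = (fun x => f i x + \sum_(j <- r) f j x)).
  exact: bmeasD.
by apply/funext => x; rewrite big_cons.
Qed.

Lemma bmeas_min d (T : measurableType d) (f g : T -> R) :
  bmeas f -> bmeas g -> bmeas (fun x => Num.min (f x) (g x)).
Proof.
move=> [mf [M fM]] [mg [N gN]]; split; first exact: measurable_minr.
exists (Num.max M N) => x; rewrite le_max.
by rewrite minEle; case: ifP => _; rewrite ?fM ?gN ?orbT.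
Qed.

Lemma bmeas_expR d (T : measurableType d) (f : T -> R) :
  bmeas f -> bmeas (fun x => expR (f x)).
Proof.
move=> [mf [M fM]]; split; first exact: measurableT_comp.
exists (expR M) => x; rewrite ger0_norm ?expR_ge0// ler_expR.
exact: le_trans (ler_norm _) (fM x).
Qed.

Lemma bmeas_comp d1 d2 (T1 : measurableType d1) (T2 : measurableType d2)
    (f : T2 -> R) (g : T1 -> T2) :
  bmeas f -> measurable_fun [set: T1] g -> bmeas (fun x => f (g x)).
Proof.
by move=> [mf [M fM]] mg; split; [exact: measurableT_comp|exists M => x].
Qed.

Lemma bmeas_curry d1 d2 (T1 : measurableType d1) (T2 : measurableType d2)
    (f : T1 * T2 -> R) (x : T1) : bmeas f -> bmeas (fun y => f (x, y)).
Proof. by move=> bf; apply: bmeas_comp bf _; exact: measurable_pair1. Qed.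

Lemma bmeas_integrable d (T : measurableType d)
    (mu : {finite_measure set T -> \bar R}) (f : T -> R) :
  bmeas f -> mu.-integrable setT (EFin \o f).
Proof.
move=> [mf [M fM]]; apply: measurable_bounded_integrable => //.
  exact: fin_num_fun_lty.
by exists M; split; [exact: num_real|move=> N MN x _; exact: le_trans (fM x) (ltW MN)].
Qed.

End bounded_measurable.

Section Rexpectation.
Context (R : realType) d (T : measurableType d) (mu : probability T R).
Implicit Types f g : T -> R.

Lemma EFin_Rint f : bmeas f -> (\int[mu]_x f x)%:E = (\int[mu]_x (f x)%:E)%E.
Proof.
by move=> bf; rewrite fineK//; apply: integrable_fin_num => //; exact: bmeas_integrable.
Qed.

Lemma RintD f g : bmeas f -> bmeas g ->
  \int[mu]_x (f x + g x) = \int[mu]_x f x + \int[mu]_x g x.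
Proof. by move=> bf bg; rewrite RintegralD//; exact: bmeas_integrable. Qed.

Lemma RintB f g : bmeas f -> bmeas g ->
  \int[mu]_x (f x - g x) = \int[mu]_x f x - \int[mu]_x g x.
Proof. by move=> bf bg; rewrite RintegralB//; exact: bmeas_integrable. Qed.

Lemma RintZ a f : bmeas f -> \int[mu]_x (a * f x) = a * \int[mu]_x f x.
Proof. by move=> bf; rewrite RintegralZl//; exact: bmeas_integrable. Qed.

Lemma Rint_cst (a : R) : \int[mu]_x a = a.
Proof.
by rewrite Rintegral_cst// [X in fine X](@probability_setT _ _ _ mu)/= mulr1.
Qed.

Lemma Rint_sum (I : Type) (r : seq I) (f : I -> T -> R) :
  (forall i, bmeas (f i)) ->
  \int[mu]_x (\sum_(i <- r) f i x) = \sum_(i <- r) \int[mu]_x f i x.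
Proof.
move=> bf; elim: r => [|i r ih].
  by rewrite big_nil; under eq_Rintegral do rewrite big_nil; rewrite Rint_cst.
rewrite big_cons -ih -RintD//; last exact: bmeas_sum.
by apply: eq_Rintegral => x _; rewrite big_cons.
Qed.

Lemma le_Rint f g : bmeas f -> bmeas g -> (forall x, f x <= g x) ->
  \int[mu]_x f x <= \int[mu]_x g x.
Proof. by move=> bf bg fg; apply: le_Rintegral => //; exact: bmeas_integrable. Qed.

(** The minimum of [f] and [g] is below [g] everywhere and equals [f] almost everywhere. *)
Lemma ae_le_Rint f g : bmeas f -> bmeas g -> {ae mu, forall x, f x <= g x} ->
  \int[mu]_x f x <= \int[mu]_x g x.
Proof.
move=> bf bg fg; have bm := bmeas_min bf bg.
apply: le_trans (le_Rint bm bg _); last by move=> x; rewrite ge_min lexx orbT.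
rewrite le_eqVlt; apply/orP; left; apply/eqP; congr fine.
apply: ae_eq_integral => //.
- by apply/measurable_EFinP; case: bf.
- by apply/measurable_EFinP; case: bm.
- by apply: filterS fg => x fgx _; rewrite min_l.
Qed.

Lemma Rint_bound f M : bmeas f -> (forall x, `|f x| <= M) -> `|\int[mu]_x f x| <= M.
Proof.
move=> bf fM; rewrite ler_norml; apply/andP; split.
  rewrite -(Rint_cst (- M)); apply: le_Rint => [||x]; [exact: bmeas_cst|by []|].
  by have := fM x; rewrite ler_norml => /andP[].
rewrite -[leRHS]Rint_cst; apply: le_Rint => [||x]; [by []|exact: bmeas_cst|].
by have := fM x; rewrite ler_norml => /andP[].
Qed.

End Rexpectation.

Section Rfubini.
Context (R : realType) d1 d2 (T1 : measurableType d1) (T2 : measurableType d2).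
Context (mu : probability T1 R) (nu : probability T2 R).

Let integrable_prod (f : T1 * T2 -> R) : bmeas f ->
  (mu \x nu)%E.-integrable setT (EFin \o f).
Proof.
move=> [mf [M fM]]; apply: measurable_bounded_integrable => //.
  have h := @probability_setT _ _ _ (mu \x nu)%E.
  by apply: (@le_lt_trans _ _ 1%E) (ltry 1); rewrite -h.
by exists M; split; [exact: num_real|move=> N MN x _; exact: le_trans (fM x) (ltW MN)].
Qed.

Lemma bmeas_Rint2 (f : T1 * T2 -> R) : bmeas f ->
  bmeas (fun x => \int[nu]_y f (x, y)).
Proof.
move=> bf; have [mf [M fM]] := bf; split; last first.
  by exists M => x; apply: Rint_bound => //; exact: bmeas_curry.
apply: measurableT_comp => //.
apply: (measurable_fubini_F (m1 := mu) (m2 := nu) (f := EFin \o f)).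
exact: integrable_prod.
Qed.

Lemma Rint_prod (f : T1 * T2 -> R) : bmeas f ->
  \int[(mu \x nu)%E]_z f z = \int[mu]_x \int[nu]_y f (x, y).
Proof.
move=> bf; rewrite {1}/Rintegral -(integral12_prod_meas1 (f := EFin \o f)).
  congr fine; apply: eq_integral => x _.
  by rewrite EFin_Rint//; exact: bmeas_curry.
exact: integrable_prod.
Qed.

Lemma Rint_prodC (f : T1 * T2 -> R) : bmeas f ->
  \int[(mu \x nu)%E]_z f z = \int[nu]_y \int[mu]_x f (x, y).
Proof.
move=> bf; rewrite {1}/Rintegral -(integral21_prod_meas1 (f := EFin \o f)).
  congr fine; apply: eq_integral => y _.
  by rewrite EFin_Rint//; apply: bmeas_comp bf _; exact: measurable_pair2.
exact: integrable_prod.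
Qed.

End Rfubini.

(** The law is given by its values on measurable sets, so that one change of variables serves
    coordinates, mapped samples and mixed samples alike. *)
Lemma Rint_law (R : realType) d1 d2 (T1 : measurableType d1)
    (T2 : measurableType d2) (mu : probability T1 R) (nu : probability T2 R)
    (p : T1 -> T2) (f : T2 -> R) :
  measurable_fun setT p ->
  (forall A, measurable A -> nu A = mu (p @^-1` A)) -> bmeas f ->
  \int[nu]_y f y = \int[mu]_x f (p x).
Proof.
move=> mp nuE bf; congr fine.
transitivity (\int[pushforward mu p]_y (f y)%:E)%E.
  by apply: eq_measure_integral => A mA _; exact: nuE.
rewrite integral_pushforward//; first by apply/measurable_EFinP; case: bf.
by rewrite preimage_setT; apply: (@bmeas_integrable _ _ _ _ (f \o p)); exact: bmeas_comp.
Qed.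

Section iid_integral.
Context (R : realType) d (T : measurableType d) (mu : probability T R).

Lemma Rint_iidS n (f : n.+1.-tuple T -> R) : bmeas f ->
  \int[iid_law mu n.+1]_z f z =
  \int[mu]_x \int[iid_law mu n]_r f (cons_pair (x, r)).
Proof.
move=> bf; have bc : bmeas (fun z => f (@cons_pair _ T n z)).
  by apply: bmeas_comp bf _; exact: measurable_cons_pair.
transitivity (\int[(mu \x iid_law mu n)%E]_z f (@cons_pair _ T n z)).
  exact: (Rint_law (@measurable_cons_pair _ T n)).
exact: Rint_prod bc.
Qed.

Lemma Rint_iid0 (f : 0.-tuple T -> R) : bmeas f -> \int[iid_law mu 0]_z f z = f [tuple].
Proof.
move=> bf; rewrite (_ : f = cst (f [tuple])); last first.
  by apply/funext => x; rewrite (tuple0 x).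
by rewrite Rint_cst.
Qed.

End iid_integral.

(** * Hoeffding's lemma *)

Lemma is_derive_ge0 (R : realType) (f df : R -> R) (h : R) :
  (forall x : R, is_derive x 1 f (df x)) -> (forall x, 0 <= x -> 0 <= df x) ->
  0 <= h -> f 0 <= f h.
Proof.
move=> fdf df0 h0.
have cf : {within `[0, h], continuous f}.
  by apply: derivable_within_continuous => x _; have := fdf x => -[].
have [c /[!in_itv]/= /andP[c0 _] E] := MVT_segment h0 (fun x _ => fdf x) cf.
by rewrite -subr_ge0 E mulr_ge0// ?subr_ge0// df0.
Qed.

Section two_point.
Context (R : realType) (p : R) (hp : 0 <= p <= 1).

Let D (x : R) := 1 - p + p * expR x.

Let D_gt0 x : 0 < D x.
Proof.
rewrite /D; have e0 := expR_gt0 x; case/andP: hp => p0 p1.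
have [->|pn0] := eqVneq p 0; first by rewrite mul0r subr0 addr0.
by rewrite ltr_wpDl ?subr_ge0// mulr_gt0// lt_neqAle eq_sym pn0.
Qed.

Let dD (x : R) : is_derive x 1 D (p * expR x).
Proof.
have hd : is_derive x 1 (cst (1 - p) + cst p * expR) (p * expR x).
  by apply: is_derive_eq; rewrite /= scaler0 add0r addr0.
exact: hd.
Qed.

(** The logarithm of a Bernoulli moment generating function has as second derivative the variance of
    a tilted Bernoulli law, at most 1/4. Here [F] is the gap of the logarithms and [G] its
    derivative; both vanish at 0, and [G] is nondecreasing because [D y ^+ 2] minus
    [4 * p * (1 - p) * expR y] is a square. *)
Lemma two_point_mgf (h : R) : 0 <= h ->
  1 - p + p * expR h <= expR (p * h + h ^+ 2 / 8).
Proof.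
move=> h0.
pose G x := p + x / 4 - p * expR x / D x.
pose F x := p * x + x ^+ 2 / 8 - ln (D x).
have dG (x : R) : is_derive x 1 G (4^-1 - p * (1 - p) * expR x / D x ^+ 2).
  have D0 : D x != 0 by rewrite gt_eqF.
  have dV := is_deriveV D0 (dD x).
  have hd : is_derive x 1 (cst p + id * cst 4^-1 -
      (cst p * expR) * (fun y => (D y)^-1))
      (4^-1 - p * (1 - p) * expR x / D x ^+ 2).
    apply: is_derive_eq; rewrite /=.
    rewrite /GRing.scale/=.
    have -> : 1 - p = D x - p * expR x by rewrite /D addrK.
    by rewrite -[(cst p * expR) x]/(p * expR x); field.
  exact: hd.
have dF (x : R) : is_derive x 1 F (G x).
  have D0 := D_gt0 x.
  have dl : is_derive x 1 (@ln R \o D) ((D x)^-1 * (p * expR x)).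
    exact: (is_derive1_comp (is_derive1_ln D0) (dD x)).
  have hd : is_derive x 1 (cst p * id + (id ^+ 2) * cst 8^-1 - (@ln R \o D)) (G x).
    apply: is_derive_eq; rewrite /= /G /GRing.scale/=.
    by field; rewrite gt_eqF.
  exact: hd.
have G0 : G 0 = 0 by rewrite /G /D expR0; field; rewrite ?subrK ?oner_neq0.
have F0 : F 0 = 0 by rewrite /F /D expR0 mulr1 subrK ln1 mulr0 expr0n/= mul0r addr0 subr0.
have Gge0 x : 0 <= x -> 0 <= G x.
  move=> x0; rewrite -G0; apply: is_derive_ge0 dG _ x0 => y _.
  rewrite subr_ge0 ler_pdivrMr ?exprn_gt0// ler_pdivlMl//.
  rewrite -subr_ge0 (_ : _ - _ = (1 - p - p * expR y) ^+ 2) ?sqr_ge0//.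
  by rewrite /D; ring.
have : 0 <= F h by rewrite -F0; apply: is_derive_ge0 dF _ h0 => y /Gge0.
by rewrite /F subr_ge0 -ler_expR (lnK (D_gt0 h)).
Qed.

End two_point.

(** The tangent inequality at [t * h] is taken at 0 and at [h]; averaged with weights [1 - t] and
    [t], its linear parts cancel. *)
Lemma expR_convex01 (R : realType) (t h : R) : 0 <= t <= 1 ->
  expR (t * h) <= 1 - t + t * expR h.
Proof.
move=> /andP[t0 t1]; set y := t * h.
have H x : expR y * (1 + (x - y)) <= expR x.
  rewrite -[in leRHS](subrKC y x) expRD ler_wpM2l ?expR_ge0//.
  exact: expR_ge1Dx.
have H0 := H 0; have Hh := H h; rewrite expR0 in H0.
have -> : expR y = (1 - t) * (expR y * (1 + (0 - y))) + t * (expR y * (1 + (h - y))).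
  by rewrite /y; ring.
apply: lerD; last exact: ler_wpM2l.
by rewrite -[leRHS]mulr1 ler_wpM2l// subr_ge0.
Qed.

(** After rescaling to the unit interval, convexity compares [g] with the two-point law of the same
    mean. The range is assumed only almost everywhere, which is all that is known of the partial
    means in the bounded-differences induction. *)
Lemma hoeffding_mgf (R : realType) d (T : measurableType d) (mu : probability T R)
    (g : T -> R) (a c lam : R) :
  bmeas g -> 0 < c -> 0 <= lam -> {ae mu, forall x, a <= g x <= a + c} ->
  \int[mu]_x expR (lam * g x) <=
    expR (lam * \int[mu]_x g x + lam ^+ 2 * c ^+ 2 / 8).
Proof.
move=> bg c0 lam0 gac.
pose th x := (g x - a) / c; pose h := lam * c.
have bth : bmeas th.
  by apply: bmeasM (bmeas_cst _ _); apply: bmeasB bg (bmeas_cst _ _).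
have bw : bmeas (fun x => (1 - th x) + th x * expR h).
  apply: bmeasD; first exact: bmeasB (bmeas_cst _ _) bth.
  exact: bmeasM bth (bmeas_cst _ _).
pose p := \int[mu]_x th x.
have th01 : {ae mu, forall x, 0 <= th x <= 1}.
  apply: filterS gac => x /andP[ag gc].
  by rewrite /th divr_ge0 ?subr_ge0 ?(ltW c0)//= ler_pdivrMr// mul1r lerBlDl.
have p01 : 0 <= p <= 1.
  apply/andP; split.
    rewrite -(Rint_cst mu 0); apply: ae_le_Rint bth _; first exact: bmeas_cst.
    by apply: filterS th01 => x /andP[].
  rewrite -[leRHS](Rint_cst mu 1); apply: ae_le_Rint (bth) _ _; first exact: bmeas_cst.
  by apply: filterS th01 => x /andP[].
have Eg : \int[mu]_x g x = a + p * c.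
  transitivity (\int[mu]_x (a + c * th x)).
    by apply: eq_Rintegral => x _; rewrite /th; field; rewrite gt_eqF.
  rewrite RintD//; [|exact: bmeas_cst|exact: bmeasZ].
  by rewrite Rint_cst RintZ// mulrC.
have Ew : \int[mu]_x ((1 - th x) + th x * expR h) = 1 - p + p * expR h.
  rewrite RintD//; last exact: bmeasM bth (bmeas_cst _ _).
    rewrite RintB//; last exact: bmeas_cst.
    rewrite Rint_cst; congr (_ + _); rewrite [RHS]mulrC -RintZ//.
    by apply: eq_Rintegral => x _; rewrite mulrC.
  exact: bmeasB (bmeas_cst _ _) bth.
apply: (@le_trans _ _ (\int[mu]_x (expR (lam * a) * ((1 - th x) + th x * expR h)))).
  apply: ae_le_Rint; [by apply/bmeas_expR/bmeasZ|exact: bmeasZ|].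
  apply: filterS th01 => x thx.
  have -> : lam * g x = lam * a + th x * h.
    by rewrite /th /h; field; rewrite gt_eqF.
  by rewrite expRD ler_wpM2l ?expR_ge0// expR_convex01.
rewrite RintZ// Ew Eg.
have -> : lam * (a + p * c) + lam ^+ 2 * c ^+ 2 / 8 = lam * a + (p * h + h ^+ 2 / 8).
  by rewrite /h; ring.
rewrite expRD ler_wpM2l ?expR_ge0// two_point_mgf//.
by rewrite mulr_ge0// ltW.
Qed.

(** * Bounded differences *)

Section measurable_lower_envelope.
Context (R : realType) d1 d2 (W : measurableType d1) (T : measurableType d2).
Context (mu : probability T R).

(** [m w] is the essential infimum of the section at [w]. It is measurable, unlike a pointwise
    infimum in general: [m w] is at least [b] exactly when the section of the set where [u < b] is
    null, and measures of sections are measurable in [w]. *)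
Lemma ess_inf_section (u : W * T -> R) : bmeas u ->
  exists m : W -> R, [/\ bmeas m,
    forall w, {ae mu, forall t, m w <= u (w, t)} &
    forall w z, (forall t, z <= u (w, t)) -> z <= m w].
Proof.
move=> [mfu [M uM]].
pose e w := ess_inf mu (fun t => (u (w, t))%:E).
have muT : (0 < mu setT)%E by rewrite [X in (0 < X)%E](@probability_setT _ _ _ mu).
have le_e w (z : R) : (z%:E <= e w)%E <-> {ae mu, forall t, z <= u (w, t)}.
  split=> [/ess_infP|H]; first by apply: filterS => t; rewrite lee_fin.
  by apply/ess_infP; apply: filterS H => t; rewrite lee_fin.
have eM w : ((- M)%:E <= e w)%E.
  by apply/le_e/aeW => t; have := uM (w, t); rewrite ler_norml => /andP[].
have Me w : (e w <= M%:E)%E.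
  rewrite -(@ess_inf_cstr _ _ _ mu M muT); apply: le_ess_inf; apply: aeW => t.
  by rewrite lee_fin (le_trans (ler_norm _)).
have fe w : (fine (e w))%:E = e w.
  by rewrite fineK// fin_numE gt_eqF ?lt_eqF// ?(le_lt_trans (Me w)) ?ltry//
    (lt_le_trans (ltNyr _) (eM w)).
have le_m w z : z <= fine (e w) <-> {ae mu, forall t, z <= u (w, t)}.
  by rewrite -lee_fin fe; exact: le_e.
exists (fun w => fine (e w)); split.
- split; last first.
    by exists M => w; rewrite ler_norml -!lee_fin fe eM Me.
  apply: (measurability (@RGenCInfty.G R)) => [|/= _ [_] [b] -> <-].
    exact: RGenCInfty.measurableE.
  apply: measurableI => //.
  pose A := [set z | u z < b].
  have mA : measurable A.
    rewrite -[A]setTI; have -> : A = u @^-1` `]-oo, b[.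
      by apply/seteqP; split=> z /=; rewrite in_itv.
    exact: mfu.
  have sE w : ~` [set t | b <= u (w, t)] = xsection A w.
    apply/seteqP; split=> t; rewrite /xsection/= inE /A/=.
      by move=> /negP; rewrite -ltNge.
    by move=> ub; apply/negP; rewrite -ltNge.
  have -> : (fun w => fine (e w)) @^-1` `[b, +oo[ = (mu \o xsection A) @^-1` [set 0%E].
    apply/seteqP; split=> w /=; rewrite in_itv/= andbT -sE.
      move=> /le_m/negligibleP; apply.
      by rewrite [X in measurable X]sE; exact: measurable_xsection.
    move=> H; apply/le_m; apply/negligibleP; last exact: H.
    by rewrite [X in measurable X]sE; exact: measurable_xsection.
  rewrite -[X in measurable X]setTI.
  by apply: (measurable_fun_xsection mu mA).
- by move=> w; apply/le_m.
- by move=> w z zu; apply/le_m/aeW.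
Qed.

End measurable_lower_envelope.

Section bounded_differences.
Context (R : realType) d (T : measurableType d) (mu : probability T R).

(** Exchanging [x] and [x'] turns this one-sided form into a bound on the absolute difference. *)
Definition bdiff n (c : R) (Z : n.-tuple T -> R) :=
  forall (k : 'I_n) (x x' : n.-tuple T),
    (forall j, j != k -> tnth x j = tnth x' j) -> Z x <= Z x' + c.

Definition tuple_split n (x : n.+1.-tuple T) : T * n.-tuple T :=
  (thead x, [tuple of behead x]).

Lemma cons_pairK n : cancel (@cons_pair _ T n) (@tuple_split n).
Proof. by case=> t r; congr pair; apply/val_inj. Qed.

Lemma tuple_splitK n : cancel (@tuple_split n) (@cons_pair _ T n).
Proof. by move=> x; rewrite [RHS]tuple_eta; apply/val_inj. Qed.

Lemma measurable_tuple_split n : measurable_fun setT (@tuple_split n).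
Proof.
apply: measurable_fun_pair; first exact: measurable_tnth.
apply/measurable_fun_tnthP => i.
rewrite (_ : _ \o _ = fun x : n.+1.-tuple T => tnth x (lift ord0 i)).
  exact: measurable_tnth.
by apply/funext => x /=; rewrite [in RHS](tuple_eta x) tnthS.
Qed.

Lemma bdiff_cons n c (Z : n.+1.-tuple T -> R) : bdiff c Z ->
  (forall t t' r, Z (cons_pair (t, r)) <= Z (cons_pair (t', r)) + c) /\
  (forall t, bdiff c (fun r => Z (cons_pair (t, r)))).
Proof.
move=> bZ; split=> [t t' r|t k x x' xx']; [apply: (bZ ord0)|apply: (bZ (lift ord0 k))];
    move=> j; case: (unliftP ord0 j) => [i ->|->] //.
  by rewrite !tnthS.
by rewrite (inj_eq lift_inj) !tnthS => /xx'.
Qed.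

(* The parameter space [Y] carries the coordinates already peeled off: the
   majorant in the remaining ones has to depend measurably on them. *)
Lemma bdiff_majorant_mgf (c lam : R) : 0 < c -> 0 <= lam ->
  forall n dY (Y : measurableType dY) (I : Type)
    (Z : I -> Y -> n.-tuple T -> R) (U : Y * n.-tuple T -> R),
  bmeas U -> (forall i y x, Z i y x <= U (y, x)) ->
  (forall i y, bdiff c (Z i y)) ->
  exists V : Y * n.-tuple T -> R, [/\ bmeas V,
    forall i y x, Z i y x <= V (y, x) &
    forall y, \int[iid_law mu n]_x expR (lam * V (y, x)) <=
      expR (lam * (\int[iid_law mu n]_x U (y, x)) +
            n%:R * (lam ^+ 2 * c ^+ 2 / 8))].
Proof.
move=> c0 lam0; elim=> [|n ih] dY Y I Z U bU ZU bZ.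
  exists U; split=> // y; have bUy := bmeas_curry y bU.
  by rewrite !Rint_iid0 ?mul0r ?addr0//; apply/bmeas_expR/bmeasZ.
(* The first sample coordinate is moved last, so that the essential infimum runs over it with the
   other variables as parameters. *)
pose u (w : Y * n.-tuple T * T) := U (w.1.1, cons_pair (w.2, w.1.2)).
have bu : bmeas u.
  apply: bmeas_comp bU _; apply: measurable_fun_pair.
    exact: measurableT_comp measurable_fst measurable_fst.
  apply: (measurableT_comp (measurable_cons_pair (n := n))).
  apply: measurable_fun_pair; first exact: measurable_snd.
  exact: measurableT_comp measurable_snd measurable_fst.
have [m [bm mu_ge mge]] := ess_inf_section mu bu.
pose U' (w : Y * T * n.-tuple T) :=
  Num.min (U (w.1.1, cons_pair (w.1.2, w.2))) (m (w.1.1, w.2) + c).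
have bm' : bmeas (fun w : Y * T * n.-tuple T => m (w.1.1, w.2)).
  apply: bmeas_comp bm _; apply: measurable_fun_pair; last exact: measurable_snd.
  exact: measurableT_comp measurable_fst measurable_fst.
have bUc : bmeas (fun w : Y * T * n.-tuple T => U (w.1.1, cons_pair (w.1.2, w.2))).
  apply: bmeas_comp bU _; apply: measurable_fun_pair.
    exact: measurableT_comp measurable_fst measurable_fst.
  apply: (measurableT_comp (measurable_cons_pair (n := n))).
  apply: measurable_fun_pair; last exact: measurable_snd.
  exact: measurableT_comp measurable_snd measurable_fst.
have bU' : bmeas U'.
  by apply: bmeas_min bUc _; apply: bmeasD bm' (bmeas_cst _ _).
pose Z' i (w : Y * T) r := Z i w.1 (cons_pair (w.2, r)).
(* The cut-off is still a majorant: bounded differences give [Z - c <= U] along the whole section,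
   hence [Z - c <= m]. *)
have ZU' i w r : Z' i w r <= U' (w, r).
  rewrite /Z' /U' le_min ZU/= -lerBlDr; apply: mge => t.
  rewrite lerBlDr; apply: (le_trans ((bdiff_cons (bZ i w.1)).1 _ t _)).
  by rewrite lerD2r; exact: ZU.
have bZ' i w : bdiff c (Z' i w) by exact: (bdiff_cons (bZ i w.1)).2.
have [V' [bV' ZV' EV']] := ih _ _ _ Z' U' bU' ZU' bZ'.
pose V (z : Y * n.+1.-tuple T) :=
  V' ((z.1, (tuple_split z.2).1), (tuple_split z.2).2).
have bV : bmeas V.
  have ms : measurable_fun setT (fun z : Y * n.+1.-tuple T => tuple_split z.2).
    exact: measurableT_comp (@measurable_tuple_split n) measurable_snd.
  apply: bmeas_comp bV' _; apply: measurable_fun_pair.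
    apply: measurable_fun_pair; first exact: measurable_fst.
    exact: measurableT_comp measurable_fst ms.
  exact: measurableT_comp measurable_snd ms.
exists V; split=> // [i y x|y].
  by have := ZV' i (y, (tuple_split x).1) (tuple_split x).2;
    rewrite /Z' -surjective_pairing tuple_splitK.
have beV : bmeas (fun x => expR (lam * V (y, x))).
  by apply/bmeas_expR/bmeasZ/bmeas_curry.
rewrite Rint_iidS//.
have VE t r : V (y, cons_pair (t, r)) = V' ((y, t), r).
  by rewrite /V cons_pairK.
pose nu := iid_law mu n.
pose K := n%:R * (lam ^+ 2 * c ^+ 2 / 8).
pose G t := \int[nu]_r U' ((y, t), r).
have mpair1 : measurable_fun setT (fun z : T * n.-tuple T => ((y, z.1), z.2)).
  apply: measurable_fun_pair; last exact: measurable_snd.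
  by apply: measurable_fun_pair; [exact: measurable_cst|exact: measurable_fst].
have bU'y : bmeas (fun z : T * n.-tuple T => U' ((y, z.1), z.2)).
  exact: bmeas_comp bU' mpair1.
have bV'y : bmeas (fun z : T * n.-tuple T => expR (lam * V' ((y, z.1), z.2))).
  by apply/bmeas_expR/bmeasZ; exact: bmeas_comp bV' mpair1.
have bG : bmeas G by exact: (bmeas_Rint2 mu nu bU'y).
pose a := \int[nu]_r m (y, r).
have bmy : bmeas (fun r => m (y, r)) by exact: bmeas_curry.
have GaP : {ae mu, forall t, a <= G t <= a + c}.
  (* [h] is the positive part of [m - U']. For each [r] it vanishes outside a null set of [t]
     depending on [r]; Fubini turns this into a single null set of [t] outside which its integral
     over [r] is zero. *)
  pose h (z : T * n.-tuple T) := m (y, z.2) - Num.min (m (y, z.2)) (U' ((y, z.1), z.2)).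
  have bmz : bmeas (fun z : T * n.-tuple T => m (y, z.2)).
    exact: bmeas_comp bmy measurable_snd.
  have bh : bmeas h by apply: (bmeasB bmz); exact: bmeas_min bmz bU'y.
  have h0 z : 0 <= h z by rewrite subr_ge0 ge_min lexx.
  pose H t := \int[nu]_r h (t, r).
  have bH : bmeas H by exact: (bmeas_Rint2 mu nu bh).
  have H0 t : 0 <= H t by apply: Rintegral_ge0.
  have EH : \int[mu]_t H t = 0.
    rewrite -(Rint_prod _ _ bh) Rint_prodC// -[RHS](Rint_cst nu 0).
    apply: eq_Rintegral => r _; rewrite -(Rint_cst mu 0); apply/le_anti/andP; split.
      apply: ae_le_Rint; [|exact: bmeas_cst|].
        by apply: bmeas_comp bh _; exact: measurable_pair2.
      apply: filterS (mu_ge (y, r)) => t mt.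
      by rewrite /h/= min_l ?subrr// /U' le_min mt/= lerDl ltW.
    apply: le_Rint => //; first exact: bmeas_cst.
    by apply: bmeas_comp bh _; exact: measurable_pair2.
  have aeH : {ae mu, forall t, H t = 0}.
    have : ae_eq mu setT (EFin \o H) (cst 0%E).
      apply/ae_eq_integral_abs => //; first by apply/measurable_EFinP; case: bH.
      under eq_integral => t _ do rewrite /= ger0_norm//.
      by rewrite -EFin_Rint// EH.
    by apply: filterS => t /(_ Logic.I) [].
  apply: filterS aeH => t Ht; apply/andP; split.
    rewrite -subr_le0 -Ht /a /G -RintB//; last exact: bmeas_curry bU'y.
    apply: le_Rint => [||r].
    - by apply: bmeasB bmy _; exact: bmeas_curry bU'y.
    - exact: bmeas_curry.
    - by rewrite /h lerD2l lerN2 ge_min lexx orbT.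
  rewrite /a /G -[X in _ + X](Rint_cst nu c) -RintD//; last exact: bmeas_cst.
  apply: le_Rint => [||r].
  - exact: bmeas_curry bU'y.
  - by apply: bmeasD bmy (bmeas_cst _ _).
  - by rewrite /U' ge_min lexx orbT.
have hoeff := hoeffding_mgf bG c0 lam0 GaP.
have beG : bmeas (fun t => expR (lam * G t)) by apply/bmeas_expR/bmeasZ.
have EG : \int[mu]_t G t <= \int[iid_law mu n.+1]_x U (y, x).
  rewrite Rint_iidS//; last exact: bmeas_curry.
  have bUy : bmeas (fun z : T * n.-tuple T => U (y, cons_pair (z.1, z.2))).
    exact: bmeas_comp bUc mpair1.
  apply: le_Rint => // [|t]; first exact: (bmeas_Rint2 mu nu bUy).
  apply: le_Rint => [||r]; [exact: bmeas_curry bU'y|exact: (bmeas_curry t bUy)|].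
  by rewrite /U' ge_min lexx.
apply: (@le_trans _ _ (\int[mu]_t (expR K * expR (lam * G t)))).
  apply: le_Rint; [|exact: bmeasZ|].
    under eq_fun do under eq_Rintegral do rewrite VE.
    exact: (bmeas_Rint2 mu nu bV'y).
  move=> t; under eq_Rintegral do rewrite VE.
  by apply: (le_trans (EV' (y, t))); rewrite addrC expRD.
rewrite RintZ//; apply: (le_trans (ler_wpM2l (expR_ge0 _) hoeff)).
have -> : n.+1%:R * (lam ^+ 2 * c ^+ 2 / 8) = K + lam ^+ 2 * c ^+ 2 / 8.
  by rewrite /K -natr1 [LHS]mulrDl mul1r.
rewrite -expRD ler_expR [leRHS]addrCA lerD2l lerD2r.
exact: ler_wpM2l.
Qed.

End bounded_differences.

Lemma markov_expR (R : realType) d (T : measurableType d) (mu : probability T R)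
    (V : T -> R) (lam b : R) : bmeas V -> 0 <= lam ->
  (mu [set x | (b <= V x)%R] <=
    (expR (- (lam * b)) * \int[mu]_x expR (lam * V x))%:E)%E.
Proof.
move=> bV lam0; set A := [set x | _].
have mA : measurable A.
  have -> : A = setT `&` V @^-1` `[b, +oo[.
    by rewrite setTI; apply/seteqP; split=> x /=; rewrite in_itv/= andbT.
  by case: bV => mV _; exact: mV.
have b1 : bmeas (\1_A : T -> R).
  split; first exact: measurable_indic.
  by exists 1 => x; rewrite indicE; case: (_ \in _); rewrite ?normr1 ?normr0.
have -> : mu A = (\int[mu]_x \1_A x)%:E.
  by rewrite EFin_Rint// integral_indic// setIT.
rewrite lee_fin -RintZ; last exact/bmeas_expR/bmeasZ.
apply: le_Rint => // [|x]; first exact/bmeasZ/bmeas_expR/bmeasZ.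
rewrite indicE; case: (boolP (x \in A)) => [|_]; last by rewrite mulr_ge0// expR_ge0.
rewrite inE /A/= => bx; rewrite -expRD -[leLHS]expR0 ler_expR addrC subr_ge0.
exact: ler_wpM2l.
Qed.

(** McDiarmid's tail bound. The event is a sublevel set of one repaired majorant, hence measurable
    and valid for all [i] at once. *)
Lemma bdiff_majorant_tail (R : realType) d (T : measurableType d)
    (mu : probability T R) (n : nat) (c eta : R) (I : Type)
    (Z : I -> n.-tuple T -> R) (U : n.-tuple T -> R) :
  (0 < n)%N -> 0 < c -> 0 < eta < 1 -> bmeas U ->
  (forall i x, Z i x <= U x) -> (forall i, bdiff c (Z i)) ->
  exists A, [/\ measurable A, ((1 - eta)%:E <= iid_law mu n A)%E &
    forall x i, A x -> Z i x <=
      \int[iid_law mu n]_x U x + c * Num.sqrt (n%:R * ln (eta^-1) / 2)].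
Proof.
move=> n0 c0 /andP[eta0 eta1] bU ZU bZ.
have nR : 0 < n%:R :> R by rewrite ltr0n.
have ell0 : 0 < ln (eta^-1) by rewrite ln_gt0// invf_gt1.
set ell := ln _ in ell0 *.
pose s := Num.sqrt (n%:R * ell / 2).
have s2 : s ^+ 2 = n%:R * ell / 2 by rewrite sqr_sqrtr// divr_ge0// mulr_ge0// ltW.
(* [lam] minimises the Chernoff exponent [n * lam ^ 2 * c ^ 2 / 8 - lam * t]; the minimum is
   [- 2 * s ^ 2 / n], which equals [- ell] by the choice of [s]. *)
pose t := c * s; pose lam := 4 * s / (n%:R * c).
have s0 : 0 <= s by exact: sqrtr_ge0.
have lam0 : 0 <= lam by rewrite divr_ge0// ?mulr_ge0// ltW.
have bU1 : bmeas (fun w : unit * n.-tuple T => U w.2) by exact: bmeas_comp bU measurable_snd.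
have [V [bV ZV EV]] := bdiff_majorant_mgf mu c0 lam0 (Z := fun i (_ : unit) => Z i)
  bU1 (fun i _ x => ZU i x) (fun i _ => bZ i).
pose W x := V (tt, x); pose b := \int[iid_law mu n]_x U x + t.
have bW : bmeas W.
  apply: (bmeas_comp bV (g := fun x => (tt, x))).
  by apply: measurable_fun_pair; [exact: measurable_cst|exact: measurable_id].
pose A := [set x | W x < b].
have mA : measurable A.
  have -> : A = setT `&` W @^-1` `]-oo, b[.
    by rewrite setTI; apply/seteqP; split=> x /=; rewrite in_itv.
  by case: bW => mW _; exact: mW.
exists A; split => // [|x i Ax]; last first.
  exact: le_trans (ZV i tt x) (ltW Ax).
rewrite -[A]setCK probability_setC; last exact: measurableC.
rewrite EFinB leeB//.
have -> : ~` A = [set x | b <= W x].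
  by apply/seteqP; split=> x /=; rewrite /A/=; [move=> /negP; rewrite -leNgt|
    move=> bx; apply/negP; rewrite -leNgt].
apply: le_trans (markov_expR _ _ bW lam0) _.
rewrite lee_fin.
apply: le_trans (ler_wpM2l (expR_ge0 _) (EV tt)) _.
rewrite -expRD -[leRHS](@lnK _ eta) ?posrelE// ler_expR.
have -> : ln eta = - ell by rewrite /ell lnV ?opprK// posrelE.
rewrite /b /t /=.
have -> : n%:R * (lam ^+ 2 * c ^+ 2 / 8) = ell.
  rewrite /lam.
  have -> : n%:R * ((4 * s / (n%:R * c)) ^+ 2 * c ^+ 2 / 8) = 2 * s ^+ 2 / n%:R.
    by field; rewrite !gt_eqF.
  by rewrite s2; field; rewrite gt_eqF.
have -> : lam * (\int[iid_law mu n]_x U x + c * s) =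
    lam * (\int[iid_law mu n]_x U x) + 2 * ell.
  rewrite mulrDr; congr (_ + _); rewrite /lam.
  have -> : 4 * s / (n%:R * c) * (c * s) = 4 * s ^+ 2 / n%:R.
    by field; rewrite !gt_eqF.
  by rewrite s2; field; rewrite gt_eqF.
lra.
Qed.

(** * Images of product measures *)

Section boxes.
Context (R : realType) d (T : measurableType d).

Definition box n (A : 'I_n -> set T) : set (n.-tuple T) :=
  [set x | forall i, A i (tnth x i)].

Lemma measurable_box n (A : 'I_n -> set T) :
  (forall i, measurable (A i)) -> measurable (box A).
Proof.
move=> mA; rewrite (_ : box A = \big[setI/setT]_(i < n)
    ((fun x => tnth x i) @^-1` A i)).
  apply: bigsetI_measurable => i _; rewrite -[X in measurable X]setTI.
  exact: (measurable_tnth i).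
rewrite -bigcap_seq; apply/seteqP; split=> [x xA i _|x xA i]; first exact: xA.
by apply: xA; rewrite /= mem_index_enum.
Qed.

(** Boxes are stable under intersection and generate the product sigma-algebra. *)
Lemma box_measure_unique n (m1 m2 : {measure set (n.-tuple T) -> \bar R}) :
  (m1 setT < +oo)%E ->
  (forall A, (forall i, measurable (A i)) -> m1 (box A) = m2 (box A)) ->
  forall B, measurable B -> m1 B = m2 B.
Proof.
move=> m1oo m12 B mB.
pose G := [set box A | A in [set A : 'I_n -> set T | forall i, measurable (A i)]].
have boxT : box (fun _ : 'I_n => setT) = setT by apply/seteqP; split.
apply: (g_sigma_algebra_measure_unique G _ (fun=> setT)) => //.
- by move=> _ [A mA <-]; exact: measurable_box.
- by move=> _; exists (fun=> setT).
- exact: bigcup_const.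
- move=> _ _ [A mA <-] [A' mA' <-]; exists (fun i => A i `&` A' i).
    by move=> i; exact: measurableI.
  apply/seteqP; split=> x /=; first by move=> H; split=> i; case: (H i).
  by move=> [H H'] i.
- by move=> _ [A mA <-]; exact: m12.
(* The generators of the tuple sigma-algebra are coordinate preimages, that is, boxes with all sides
   but one full. *)
- move: B mB; apply: smallest_sub; first exact: smallest_sigma_algebra.
  move=> C; rewrite -bigcup_seq => -[i _ [A mA <-]].
  apply: sub_sigma_algebra; exists (fun j => if j == i then A else setT).
    by move=> j; case: ifP.
  rewrite setTI; apply/seteqP; split=> x /=; first by move/(_ i); rewrite eqxx.
  by move=> Ax j; case: eqP => // ->.
Qed.

End boxes.

Section iid_laws.
Context (R : realType) d1 d2 (S : measurableType d1) (T : measurableType d2).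

(** Reduces to boxes the claim that a random tuple built on any probability space is an i.i.d.
    sample. *)
Lemma iid_law_unique n (m : probability S R) (nu : probability T R)
    (p : S -> n.-tuple T) : measurable_fun setT p ->
  (forall A, (forall i, measurable (A i)) ->
     m (p @^-1` box A) = (\prod_(i < n) nu (A i))%E) ->
  forall B, measurable B -> iid_law nu n B = m (p @^-1` B).
Proof.
move=> mp mpE.
pose pm : {mfun S >-> n.-tuple T} := HB.pack p (isMeasurableFun.Build _ _ _ _ p mp).
apply: (box_measure_unique (m1 := iid_law nu n) (m2 := distribution m pm)).
  by rewrite [X in (X < _)%E]probability_setT ltry.
move=> A mA; rewrite [LHS]iid_law_box//.
by rewrite -mpE.
Qed.

End iid_laws.

Section iid_images.
Context (R : realType) d1 d2 (S : measurableType d1) (T : measurableType d2).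

Lemma measurable_tmap (p : S -> T) n : measurable_fun setT p ->
  measurable_fun setT (fun z : n.-tuple S => map_tuple p z).
Proof.
move=> mp; apply/measurable_fun_tnthP => i.
rewrite (_ : _ \o _ = fun z : n.-tuple S => p (tnth z i)).
  by apply: measurableT_comp mp _; exact: measurable_tnth.
by apply/funext => z /=; rewrite tnth_map.
Qed.

Lemma iid_law_map (mu : probability S R) (nu : probability T R) (p : S -> T) n :
  measurable_fun setT p ->
  (forall A, measurable A -> nu A = mu (p @^-1` A)) ->
  forall B, measurable B ->
    iid_law nu n B = iid_law mu n ((fun z => map_tuple p z) @^-1` B).
Proof.
move=> mp nuE; apply: iid_law_unique; first exact: measurable_tmap.
move=> A mA; transitivity (iid_law mu n (box (fun i => p @^-1` A i))).
  congr (iid_law _ _ _); apply/seteqP; split=> z /= H i.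
    by have := H i; rewrite tnth_map.
  by rewrite tnth_map; exact: H.
rewrite [LHS]iid_law_box; first by apply: eq_bigr => i _; rewrite nuE.
by move=> i; rewrite -[X in measurable X]setTI; exact: mp.
Qed.

Lemma iid_law_tnth (mu : probability S R) n (i : 'I_n) (B : set S) :
  measurable B -> mu B = iid_law mu n ((fun z => tnth z i) @^-1` B).
Proof.
move=> mB; transitivity (iid_law mu n (box (fun j => if j == i then B else setT))).
  rewrite [RHS]iid_law_box; last by move=> j; case: ifP.
  rewrite (bigD1 i)//= eqxx big1 ?mule1// => j /negPf ->.
  exact: probability_setT.
congr (iid_law _ _ _); apply/seteqP; split=> x /=; first by move/(_ i); rewrite eqxx.
by move=> Bx j; case: eqP => // ->.
Qed.

Definition tuple_mix n (s : {ffun 'I_n -> bool}) (w : n.-tuple S * n.-tuple S) :=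
  [tuple if s i then tnth w.1 i else tnth w.2 i | i < n].

Lemma measurable_tuple_mix n (s : {ffun 'I_n -> bool}) :
  measurable_fun setT (tuple_mix s).
Proof.
apply/measurable_fun_tnthP => i.
rewrite (_ : _ \o _ = fun w : n.-tuple S * n.-tuple S =>
    if s i then tnth w.1 i else tnth w.2 i).
  case: (s i).
    exact: measurableT_comp (measurable_tnth i) measurable_fst.
  exact: measurableT_comp (measurable_tnth i) measurable_snd.
by apply/funext => w /=; rewrite tnth_mktuple.
Qed.

Lemma iid_law_mix (mu : probability S R) n (s : {ffun 'I_n -> bool}) B :
  measurable B ->
  iid_law mu n B = (iid_law mu n \x iid_law mu n)%E (tuple_mix s @^-1` B).
Proof.
apply: (iid_law_unique (m := (iid_law mu n \x iid_law mu n)%E));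
  first exact: measurable_tuple_mix.
move=> A mA.
(* The preimage of a box is a product of two boxes: each side [A i] constrains only the sample
   selected by [s i], and the other side is full. *)
pose A1 i := if s i then A i else setT.
pose A2 i := if s i then setT else A i.
have mA1 i : measurable (A1 i) by rewrite /A1; case: ifP.
have mA2 i : measurable (A2 i) by rewrite /A2; case: ifP.
rewrite (_ : _ @^-1` _ = box A1 `*` box A2).
  rewrite [LHS]product_measure1E; [|exact: measurable_box..].
  rewrite [X in (X * _)%E]iid_law_box// [X in (_ * X)%E]iid_law_box//.
  rewrite -big_split/=; apply: eq_bigr => i _; rewrite /A1 /A2.
  by case: (s i); rewrite ?[X in (X * _)%E]probability_setT
    ?[X in (_ * X)%E]probability_setT ?mul1e ?mule1.
apply/seteqP; split=> [[x y]/= H|[x y]/= [H1 H2] i].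
  by split=> i; have := H i; rewrite tnth_mktuple /A1 /A2/=; case: (s i).
rewrite tnth_mktuple/=; have := H1 i; have := H2 i; rewrite /A1 /A2.
by case: (s i).
Qed.

End iid_images.

(** * Contraction and symmetrisation *)

Section contraction.
Context (R : realType).

(* The upper bounds [Bp - L * t] and [Bm + L * t] on [A] cross at
   [t = (Bp - Bm) / (2 * L)]. *)
Lemma contraction_step (L A t Bp Bm : R) (phi : R -> R) : 0 < L ->
  (forall u v, `|phi u - phi v| <= L * `|u - v|) ->
  A + L * t <= Bp -> A - L * t <= Bm ->
  A + phi t <= (Bp + Bm) / 2 + phi ((Bp - Bm) / (2 * L)).
Proof.
move=> L0 phiL hp hm; set t0 := (Bp - Bm) / (2 * L).
have Lt0 : L * t0 = (Bp - Bm) / 2 by rewrite /t0; field; rewrite gt_eqF.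
have := le_trans (ler_norm _) (phiL t t0).
case: (leP t t0) => tt0.
  rewrite distrC ger0_norm ?subr_ge0// mulrBr Lt0; lra.
by rewrite gtr0_norm ?subr_gt0// mulrBr Lt0; lra.
Qed.

Definition sign_flip n (i : 'I_n) (s : {ffun 'I_n -> bool}) : {ffun 'I_n -> bool} :=
  [ffun j => if j == i then ~~ s j else s j].

Lemma sign_flipK n (i : 'I_n) : involutive (sign_flip i).
Proof. by move=> s; apply/ffunP => j; rewrite !ffunE; case: eqP => // _; rewrite negbK. Qed.

Lemma sum_sign_flip0 n (i : 'I_n) (h : {ffun 'I_n -> bool} -> R) :
  (forall s, h (sign_flip i s) = - h s) -> \sum_s h s = 0.
Proof.
move=> hN; set S := \sum_s h s.
have : S = - S.
  rewrite {1}/S (reindex_inj (inv_inj (@sign_flipK n i))) -sumrN.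
  by apply: eq_bigr => s _; rewrite hN.
lra.
Qed.

Lemma sum_sign_flip n (i : 'I_n) (h : {ffun 'I_n -> bool} -> R) :
  \sum_s h (sign_flip i s) = \sum_s h s.
Proof. by rewrite [RHS](reindex_inj (inv_inj (@sign_flipK n i))). Qed.

Context d (T : measurableType d) (L : R) (phi : T -> R -> R).
Hypothesis L0 : 0 < L.
Hypothesis mphi : measurable_fun setT (fun z : T * R => phi z.1 z.2).
Hypothesis phiL : forall z u v, `|phi z u - phi z v| <= L * `|u - v|.
Hypothesis phi0 : forall z, phi z 0 = 0.

Lemma bmeas_lip d' (S : measurableType d') (p : S -> T) (q : S -> R) :
  measurable_fun setT p -> bmeas q -> bmeas (fun x => phi (p x) (q x)).
Proof.
move=> mp [mq [M qM]]; split.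
  apply: (measurableT_comp mphi (g := fun x => (p x, q x))).
  exact: measurable_fun_pair.
exists (L * M) => x; have := phiL (p x) (q x) 0; rewrite phi0 !subr0 => /le_trans.
by apply; rewrite ler_wpM2l// ltW.
Qed.

(* The Ledoux-Talagrand contraction, carried out on majorants: replacing
   [L * u] by [phi u] in one coordinate turns majorants of the signed sums into
   majorants whose sum over all signs is unchanged. *)
Lemma contraction_majorants n (I : Type) (g : I -> T -> R)
    (B : {ffun 'I_n -> bool} -> n.-tuple T -> R) :
  (forall s, bmeas (B s)) ->
  (forall i (s : {ffun 'I_n -> bool}) z,
     \sum_(j < n) (-1) ^+ s j * (L * g i (tnth z j)) <= B s z) ->
  exists C : {ffun 'I_n -> bool} -> n.-tuple T -> R, [/\
    forall s, bmeas (C s),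
    forall i (s : {ffun 'I_n -> bool}) z,
      \sum_(j < n) (-1) ^+ s j * phi (tnth z j) (g i (tnth z j)) <= C s z &
    forall z, \sum_s C s z = \sum_s B s z].
Proof.
move=> bB gB.
(* Hybrid sums: the first [k] coordinates already carry [phi], the others still carry [L * g]. *)
pose term k i (z : n.-tuple T) (j : 'I_n) :=
  if (j < k)%N then phi (tnth z j) (g i (tnth z j)) else L * g i (tnth z j).
suff H k : (k <= n)%N -> exists C : {ffun 'I_n -> bool} -> n.-tuple T -> R, [/\
    forall s, bmeas (C s),
    forall i (s : {ffun 'I_n -> bool}) z, \sum_(j < n) (-1) ^+ s j * term k i z j <= C s z &
    forall z, \sum_s C s z = \sum_s B s z].
  have [C [bC gC CB]] := H n (leqnn n); exists C; split=> // i s z.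
  apply: le_trans (gC i s z); rewrite le_eqVlt; apply/orP; left; apply/eqP.
  by apply: eq_bigr => j _; rewrite /term ltn_ord.
elim: k => [_|k ih kn]; first by exists B.
have [C [bC gC CB]] := ih (ltnW kn).
pose k0 := Ordinal kn; pose F s := sign_flip k0 s.
(* The right-hand side of [contraction_step], with the majorants at [s] and at its flip as [Bp] and
   [Bm]. The correction [h] is odd under the flip, so it disappears from the sum over all signs. *)
pose h (s : {ffun 'I_n -> bool}) z := (-1) ^+ s k0 *
  phi (tnth z k0) ((-1) ^+ s k0 * ((C s z - C (F s) z) / (2 * L))).
pose C' (s : {ffun 'I_n -> bool}) z := (C s z + C (F s) z) / 2 + h s z.
have sF s : F s k0 = ~~ s k0 by rewrite ffunE eqxx.
exists C'; split.
- move=> s; apply: bmeasD.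
    by apply: bmeasM (bmeas_cst _ _); exact: bmeasD.
  apply/bmeasZ/bmeas_lip; first exact: measurable_tnth.
  by apply/bmeasZ; apply: bmeasM (bmeas_cst _ _); exact: bmeasB.
- move=> i s z; rewrite (bigD1 k0)//=.
  set A := \sum_(_ < n | _) _.
  have Es : A + L * ((-1) ^+ s k0 * g i (tnth z k0)) <= C s z.
    apply: le_trans (gC i s z); rewrite [leRHS](bigD1 k0)//= [leRHS]addrC {2}/term ltnn.
    rewrite mulrCA lerD2r /A le_eqVlt; apply/orP; left; apply/eqP.
    apply: eq_bigr => j jk; congr (_ * _); rewrite /term ltnS.
    by rewrite [in LHS]leq_eqVlt -[_ == k]/(j == k0) (negPf jk).
  have Ef : A - L * ((-1) ^+ s k0 * g i (tnth z k0)) <= C (F s) z.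
    apply: le_trans (gC i (F s) z); rewrite [leRHS](bigD1 k0)//= [leRHS]addrC {2}/term ltnn.
    rewrite sF signrN mulrCA mulNr lerD2r /A le_eqVlt; apply/orP; left; apply/eqP.
    apply: eq_bigr => j jk; rewrite ffunE (negPf jk); congr (_ * _); rewrite /term ltnS.
    by rewrite [in LHS]leq_eqVlt -[_ == k]/(j == k0) (negPf jk).
  (* The step is applied to the conjugate of [phi] by the sign of coordinate [k0], which is again
     [L]-Lipschitz, so both values of the sign are treated together. *)
  have := @contraction_step L A _ _ _
    (fun u => (-1) ^+ s k0 * phi (tnth z k0) ((-1) ^+ s k0 * u)) L0 _ Es Ef.
  rewrite /= signrMK /C' /h addrC {1}/term ltnS leqnn; apply.
  move=> u v; rewrite -mulrBr normrM normr_sign mul1r (le_trans (phiL _ _ _))//.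
  by rewrite -mulrBr normrM normr_sign mul1r.
- move=> z; rewrite -CB /C' big_split/= -mulr_suml big_split/= (sum_sign_flip k0 (C^~ z)).
  rewrite (@sum_sign_flip0 _ k0 (h^~ z)) ?addr0; last first.
    move=> s; rewrite /h sF /F sign_flipK signrN mulNr; congr (- (_ * phi _ _)).
    by rewrite !mulNr -mulrN -mulNr opprB.
  by field.
Qed.

End contraction.

(** * Measurable majorants realising outer expectations and Rademacher complexities *)

Section outer_majorant.
Context (R : realType) d (T : measurableType d) (mu : probability T R).
Local Open Scope ereal_scope.

Lemma outer_expectation_bounds (Z : T -> \bar R) (b : R) :
  (forall x, 0 <= Z x <= b%:E) -> 0 <= outer_expectation mu Z <= b%:E.
Proof.
move=> Zb; apply/andP; split.
  apply: le_ereal_inf_tmp => _ [U [mU ZU] <-]; apply: integral_ge0 => x _.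
  by apply: le_trans (ZU x); case/andP: (Zb x).
apply: ge_ereal_inf; exists b%:E; last by [].
exists (cst b%:E).
  by split; [exact: measurable_cst|move=> x; case/andP: (Zb x)].
by rewrite integral_cst//= [X in _ * X](@probability_setT _ _ _ mu) mule1.
Qed.

(** A nearly optimal extended majorant is truncated at [b]: it still dominates [Z], its integral
    does not grow, and it becomes real and bounded. *)
Lemma outer_expectation_majorant (Z : T -> \bar R) (b e : R) :
  (0 < e)%R -> (forall x, 0 <= Z x <= b%:E) ->
  exists B : T -> R, [/\ bmeas B, forall x, Z x <= (B x)%:E &
    (\int[mu]_x B x <= fine (outer_expectation mu Z) + e)%R].
Proof.
move=> e0 Zb; have /andP[oe0 oeb] := outer_expectation_bounds Zb.
have fo : outer_expectation mu Z \is a fin_num.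
  by rewrite ge0_fin_numE// (le_lt_trans oeb)// ltry.
have [_ [U [mU ZU] <-] Ue] := lb_ereal_inf_adherent e0 fo.
pose V x := mine (U x) b%:E.
have U0 x : 0 <= U x by apply: le_trans (ZU x); case/andP: (Zb x).
have b0 (x : T) : (0 <= b)%R by case/andP: (Zb x) => /le_trans /[apply]; rewrite lee_fin.
have V0 x : 0 <= V x by rewrite /V le_min U0 lee_fin (b0 x).
have Vb x : V x <= b%:E by rewrite /V ge_min lexx orbT.
have fV x : (fine (V x))%:E = V x.
  by rewrite fineK// ge0_fin_numE// (le_lt_trans (Vb x))// ltry.
have mV : measurable_fun setT V.
  by apply: measurable_mine => //; exact: measurable_cst.
have bB : bmeas (fun x => fine (V x)).
  split; first exact: measurableT_comp mV.
  by exists b => x; rewrite ger0_norm ?fine_ge0// -lee_fin fV.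
exists (fun x => fine (V x)); split=> // [x|].
  by rewrite fV /V le_min ZU; case/andP: (Zb x).
rewrite -lee_fin EFin_Rint// EFinD fineK//.
apply: le_trans (ltW Ue); apply: ge0_le_integral => //=.
- by move=> x _; rewrite fV.
- by apply/measurable_EFinP; case: bB.
- by move=> x _; rewrite fV /V ge_min lexx.
Qed.

End outer_majorant.

Section rademacher_majorant.
Context (R : realType) d (X : measurableType d) (nu : probability X R) (n : nat).
Context (G : set (X -> R)) (g0 : X -> R) (b : R).
Hypothesis Gg0 : G g0.
Hypothesis Gb : forall g x, G g -> `|g x| <= b.
Hypothesis n_gt0 : (0 < n)%N.

Let Z (s : {ffun 'I_n -> bool}) (x : n.-tuple X) : \bar R :=
  ereal_sup [set `|n%:R^-1 * \sum_(i < n) (-1) ^+ s i * g (tnth x i)|%:E | g in G].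

Let Zb s x : (0 <= Z s x <= b%:E)%E.
Proof.
apply/andP; split.
  by apply: le_ereal_sup_tmp; exists `|n%:R^-1 * \sum_(i < n) (-1) ^+ s i * g0 (tnth x i)|%:E;
    [exists g0|rewrite lee_fin].
apply: ge_ereal_sup => _ [g Gg <-]; rewrite lee_fin normrM ger0_norm ?invr_ge0//.
rewrite ler_pdivrMl ?ltr0n//; apply: le_trans (ler_norm_sum _ _ _) _.
rewrite (@le_trans _ _ (\sum_(i < n) b))//; last first.
  by rewrite sumr_const card_ord mulr_natl.
by apply: ler_sum => i _; rewrite normrM normr_sign mul1r Gb.
Qed.

Lemma rademacherE : rademacher nu n G =
  (2 ^- n * \sum_(s : {ffun 'I_n -> bool}) fine (outer_expectation (iid_law nu n) (Z s)))%:E.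
Proof.
rewrite /rademacher EFinM; congr (_ * _)%E; rewrite -sumEFin; apply: eq_bigr => s _.
have /andP[oe0 oeb] := outer_expectation_bounds (iid_law nu n) (Zb s).
by rewrite fineK// ge0_fin_numE// (le_lt_trans oeb)// ltry.
Qed.

Lemma rademacher_ge0 : 0 <= fine (rademacher nu n G).
Proof.
rewrite rademacherE/= mulr_ge0// sumr_ge0// => s _; apply: fine_ge0.
by have /andP[] := outer_expectation_bounds (iid_law nu n) (Zb s).
Qed.

Lemma rademacher_majorant (e : R) : 0 < e ->
  exists B : {ffun 'I_n -> bool} -> n.-tuple X -> R, [/\
    forall s, bmeas (B s),
    forall (s : {ffun 'I_n -> bool}) x g, G g ->
      n%:R^-1 * \sum_(i < n) (-1) ^+ s i * g (tnth x i) <= B s x &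
    2 ^- n * (\sum_s \int[iid_law nu n]_x B s x) <= fine (rademacher nu n G) + e].
Proof.
move=> e0; have /choice[B HB] :=
  fun s => outer_expectation_majorant (iid_law nu n) e0 (Zb s).
exists B; split=> [s|s x g Gg|]; first by case: (HB s).
  rewrite -lee_fin; case: (HB s) => _ /(_ x) ZB _; apply: le_trans ZB.
  apply: le_ereal_sup_tmp; exists `|n%:R^-1 * \sum_(i < n) (-1) ^+ s i * g (tnth x i)|%:E;
    first by exists g.
  by rewrite lee_fin ler_norm.
rewrite rademacherE/=.
(* Each of the [2 ^ n] sign patterns has its own slack [e]; the average over signs is again [e]. *)
have -> : e = 2 ^- n * (\sum_(s : {ffun 'I_n -> bool}) e).
  rewrite sumr_const card_ffun card_bool card_ord -[e *+ _]mulr_natl natrX mulrA.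
  by rewrite mulVf ?mul1r// expf_neq0.
rewrite -mulrDr -big_split/= ler_wpM2l//; apply: ler_sum => s _.
by case: (HB s).
Qed.

End rademacher_majorant.

(** * Uniform deviations of a Lipschitz loss composed with a class on covariates *)

Section uniform_deviation.
Context (R : realType) dX (X : measurableType dX) dT (T : measurableType dT).
Context (mu : probability T R) (nu : probability X R) (pi : T -> X).
Hypothesis mpi : measurable_fun setT pi.
Hypothesis nuE : forall A, measurable A -> nu A = mu (pi @^-1` A).
Context (G : set (X -> R)) (g0 : X -> R) (b : R).
Hypothesis Gg0 : G g0.
Hypothesis mG : forall g, G g -> measurable_fun setT g.
Hypothesis Gb : forall g x, G g -> `|g x| <= b.
Context (phi : T -> R -> R) (L K : R).
Hypothesis L0 : 0 < L.
Hypothesis K0 : 0 < K.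
Hypothesis mphi : measurable_fun setT (fun z : T * R => phi z.1 z.2).
Hypothesis phiL : forall z u v, `|phi z u - phi z v| <= L * `|u - v|.
Hypothesis phi0 : forall z, phi z 0 = 0.
Hypothesis phiK : forall z g, G g -> `|phi z (g (pi z))| <= K.

Let I := {g : X -> R | G g}.
Let psi (i : I) z := phi z (sval i (pi z)).

Let bpsi i : bmeas (psi i).
Proof.
apply: (bmeas_lip L0 mphi phiL phi0 (p := id)); first exact: measurable_id.
split; first by apply: measurableT_comp mpi; exact: mG (svalP i).
by exists b => z; apply: Gb; exact: svalP.
Qed.

Let bpsi_tnth n i (j : 'I_n) : bmeas (fun z : n.-tuple T => psi i (tnth z j)).
Proof. by apply: (bmeas_comp (bpsi i)); exact: measurable_tnth. Qed.

(** Population minus empirical mean is the direction in which an empirical minimiser is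
    controlled. *)
Definition deviation n (i : I) (z : n.-tuple T) :=
  \int[mu]_t psi i t - n%:R^-1 * \sum_(j < n) psi i (tnth z j).

(** A single summand changes, between two values of modulus at most [K]. *)
Lemma bdiff_deviation n i : (0 < n)%N -> bdiff (2 * K / n%:R) (@deviation n i).
Proof.
move=> n0 k x x' xx'; rewrite /deviation -addrA lerD2l -lerBlDl opprK addrC.
rewrite -mulrBr mulrC ler_wpM2r ?invr_ge0//.
rewrite (bigD1 k)//= [X in _ - X](bigD1 k)//=.
rewrite (eq_bigr (fun j => psi i (tnth x j))); last by move=> j jk; rewrite xx'.
have := phiK (tnth x k) (svalP i); have := phiK (tnth x' k) (svalP i).
rewrite -!/(psi i _) !ler_norml => /andP[? ?] /andP[? ?]; lra.
Qed.

(* [tuple_mix s (z, z')] has the law of a single sample, so signed sums over it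
   can be majorised for each [s] separately before averaging over [s]. *)
Lemma ghost_difference n i (z z' : n.-tuple T) :
  \sum_(j < n) (psi i (tnth z' j) - psi i (tnth z j)) =
  2 / 2 ^+ n * \sum_(s : {ffun 'I_n -> bool}) \sum_(j < n)
     (-1) ^+ s j * psi i (tnth (tuple_mix s (z, z')) j).
Proof.
rewrite exchange_big/= mulr_sumr; apply: eq_bigr => j _.
set D := psi i _ - _.
(* For the two values of [s j] the signed term is minus the value at [z] or plus the value at [z'].
   Its mean is [D / 2], so the centred term is odd; this is the source of the factor 2. *)
pose h (s : {ffun 'I_n -> bool}) :=
  (-1) ^+ s j * psi i (tnth (tuple_mix s (z, z')) j) - D / 2.
have -> : \sum_(s : {ffun 'I_n -> bool}) (-1) ^+ s j * psi i (tnth (tuple_mix s (z, z')) j) =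
    \sum_s (h s + D / 2).
  by apply: eq_bigr => s _; rewrite /h subrK.
rewrite big_split/= (@sum_sign_flip0 _ _ j h) ?add0r.
  rewrite sumr_const card_ffun card_bool card_ord -[(D / 2) *+ _]mulr_natr natrX.
  by field; rewrite expf_neq0.
move=> s; rewrite /h !tnth_mktuple/= ffunE eqxx /D.
by case: (s j); rewrite /= ?expr0 ?expr1; field.
Qed.

(** Symmetrisation contributes 2 and contraction contributes [L]. The contraction acts on majorants
    over one sample, for each sign pattern, and the ghost sample is mixed in only afterwards. *)
Lemma deviation_majorant n (e : R) : (0 < n)%N -> 0 < e ->
  exists U : n.-tuple T -> R, [/\ bmeas U, forall i z, deviation i z <= U z &
    \int[iid_law mu n]_z U z <= 2 * L * (fine (rademacher nu n G) + e)].
Proof.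
move=> n0 e0; have nR : 0 < n%:R :> R by rewrite ltr0n.
have [B [bB GB EB]] := rademacher_majorant nu Gg0 Gb n0 e0.
have mmap : measurable_fun setT (fun z : n.-tuple T => map_tuple pi z).
  exact: measurable_tmap.
(* The factor [L * n] passes from normalised averages of [g] to the unnormalised sums of [L * g]
   that contraction expects. *)
pose B' s (z : n.-tuple T) := (L * n%:R) * B s (map_tuple pi z).
have bB'0 s : bmeas (fun z : n.-tuple T => B s (map_tuple pi z)).
  exact: bmeas_comp (bB s) mmap.
have bB' s : bmeas (B' s) by exact: bmeasZ.
have gB' (i : I) (s : {ffun 'I_n -> bool}) z :
    \sum_(j < n) (-1) ^+ s j * (L * sval i (pi (tnth z j))) <= B' s z.
  have := GB s (map_tuple pi z) _ (svalP i).
  rewrite ler_pdivrMl// => H; rewrite /B' -mulrA.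
  under eq_bigr do rewrite mulrCA; rewrite -mulr_sumr ler_wpM2l ?(ltW L0)//.
  by apply: le_trans H; under [leRHS]eq_bigr do rewrite tnth_map.
have [C [bC gC CB]] := contraction_majorants L0 mphi phiL phi0
  (g := fun (i : I) t => sval i (pi t)) bB' gB'.
pose a := 2 / 2 ^+ n / n%:R : R.
pose W (w : n.-tuple T * n.-tuple T) := a * \sum_s C s (tuple_mix s w).
have bCm s : bmeas (fun w => C s (tuple_mix s w)).
  by apply: bmeas_comp (bC s) _; exact: measurable_tuple_mix.
have bW : bmeas W by apply/bmeasZ/bmeas_sum.
have a0 : 0 <= a by rewrite /a !divr_ge0// exprn_ge0.
pose P := iid_law mu n.
exists (fun z => \int[P]_z' W (z, z')); split.
- exact: (bmeas_Rint2 P P bW).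
- move=> i z.
  (* The population mean is rewritten as the expected mean over a ghost sample [z']. *)
  have -> : deviation i z = \int[P]_z' (n%:R^-1 *
      \sum_(j < n) (psi i (tnth z' j) - psi i (tnth z j))).
    rewrite RintZ; last first.
      by apply: bmeas_sum => j; apply: bmeasB (bmeas_cst _ _); exact: bpsi_tnth.
    rewrite Rint_sum; last first.
      by move=> j; apply: bmeasB (bmeas_cst _ _); exact: bpsi_tnth.
    transitivity (n%:R^-1 * \sum_(j < n) (\int[mu]_t psi i t - psi i (tnth z j))).
      rewrite sumrB sumr_const card_ord -[(\int[mu]_t psi i t) *+ _]mulr_natl.
      rewrite mulrBr mulrA mulVf ?mul1r//.
      by rewrite gt_eqF.
    congr (_ * _); apply: eq_bigr => j _.
    rewrite RintB; [|exact: bpsi_tnth|exact: bmeas_cst].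
    rewrite Rint_cst.
    congr (_ - _); apply: Rint_law (bpsi i); first exact: measurable_tnth.
    by move=> A mA; exact: iid_law_tnth.
  apply: le_Rint => [||z'].
  + apply/bmeasZ/bmeas_sum => j; apply: bmeasB (bmeas_cst _ _); exact: bpsi_tnth.
  + exact: bmeas_curry.
  + rewrite ghost_difference /W /a mulrA [_^-1 * _]mulrC ler_wpM2l//.
    by apply: ler_sum => s _; exact: gC.
- rewrite -(Rint_prod P P bW) /W RintZ; last exact: bmeas_sum.
  rewrite Rint_sum//.
  (* For fixed [s] the mixed tuple is a plain i.i.d. sample, so the integrals reduce to those of
     [C s], whose sum over signs is that of [B']. *)
  have mixE s : \int[(P \x P)%E]_w C s (tuple_mix s w) = \int[P]_z C s z.
    apply/esym; apply: (@Rint_law _ _ _ _ _ (P \x P)%E P) (bC s).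
      exact: measurable_tuple_mix.
    by move=> A mA; exact: iid_law_mix.
  under eq_bigr do rewrite mixE.
  rewrite -Rint_sum//; under eq_Rintegral do rewrite CB.
  rewrite Rint_sum//.
  have B'E s : \int[P]_z B' s z = L * n%:R * \int[iid_law nu n]_x B s x.
    rewrite /B' RintZ//; congr (_ * _); apply/esym; apply: Rint_law (bB s) => //.
    by move=> A mA; exact: iid_law_map.
  under eq_bigr do rewrite B'E.
  rewrite -mulr_sumr.
  have -> : a * (L * n%:R * (\sum_s \int[iid_law nu n]_x B s x)) =
      2 * L * (2 ^- n * (\sum_s \int[iid_law nu n]_x B s x)).
    by rewrite /a; field; rewrite ?expf_neq0 ?gt_eqF.
  by rewrite ler_wpM2l// mulr_ge0// ltW.
Qed.

(** Concentration around the mean of the majorant, with [c = 2 * K / n] and the slack divided by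
    [2 * L] so that it becomes [e] after scaling. *)
Theorem uniform_deviation n (e eta : R) : (0 < n)%N -> 0 < e -> 0 < eta < 1 ->
  exists A, [/\ measurable A, ((1 - eta)%:E <= iid_law mu n A)%E &
    forall (z : n.-tuple T) g, A z -> G g ->
      \int[mu]_t phi t (g (pi t)) -
        n%:R^-1 * \sum_(j < n) phi (tnth z j) (g (pi (tnth z j))) <=
      2 * L * fine (rademacher nu n G) + e +
        K * Num.sqrt (2 * ln (eta^-1)) / Num.sqrt n%:R].
Proof.
move=> n0 e0 eta01; have nR : 0 < n%:R :> R by rewrite ltr0n.
have e'0 : 0 < e / (2 * L) by rewrite divr_gt0// mulr_gt0.
have [U [bU devU EU]] := deviation_majorant n0 e'0.
have c0 : 0 < 2 * K / n%:R by rewrite divr_gt0// mulr_gt0.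
have [A [mA PA HA]] := bdiff_majorant_tail mu n0 c0 eta01 bU devU
  (fun i => bdiff_deviation i n0).
exists A; split=> // z g Az Gg.
apply: (le_trans (HA z (exist _ g Gg) Az)); apply: lerD.
  apply: (le_trans EU); rewrite mulrDr lerD2l.
  by rewrite mulrC divfK// gt_eqF// mulr_gt0.
have -> : n%:R * ln eta^-1 / 2 = (2 * ln eta^-1) * (n%:R / 4) :> R by field.
have ell0 : 0 <= 2 * ln (eta^-1) by case/andP: eta01 => ? ?;
  rewrite mulr_ge0// ln_ge0// invf_ge1// ltW.
rewrite sqrtrM//.
have -> : Num.sqrt (n%:R / 4) = Num.sqrt n%:R / 2 :> R.
  by rewrite sqrtrM// sqrtrV// (_ : 4 = 2 ^+ 2) ?sqrtr_sqr ?normr_nat//; ring.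
set s := Num.sqrt n%:R; have s0 : 0 < s by rewrite sqrtr_gt0.
have -> : n%:R = s ^+ 2 :> R by rewrite sqr_sqrtr// ltW.
by rewrite le_eqVlt; apply/orP; left; apply/eqP; field; rewrite gt_eqF.
Qed.

End uniform_deviation.

(** * Transfer of integrals *)

Section weighted_image.
Context (R : realType) dX (X : measurableType dX).
Local Open Scope ereal_scope.
Import HBNNSimple.

(** Monotone convergence along simple functions below [w]. The right-hand side depends on [m], [pi]
    and [p] only through integrals of [p] over preimages of subsets of [X]. *)
Lemma integral_comp_approx d (S : measurableType d) (m : {measure set S -> \bar R})
    (pi : S -> X) (p : S -> R) (w : X -> R)
    (mw : measurable_fun [set: X] (EFin \o w)) :
  measurable_fun [set: S] pi -> measurable_fun [set: S] p ->
  (forall z, 0 <= p z)%R -> (forall x, 0 <= w x)%R ->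
  \int[m]_z (w (pi z) * p z)%:E =
  limn (fun n => let h := nnsfun_approx measurableT mw n in
    \sum_(k \in range h) (k%:E * \int[m]_(z in pi @^-1` (h @^-1` [set k])) (p z)%:E)).
Proof.
move=> mpi mp p0 w0; pose h := nnsfun_approx measurableT mw.
have w0' x : setT x -> 0 <= (EFin \o w) x by move=> _; rewrite lee_fin.
have mhpi n : measurable_fun setT (fun z => h n (pi z)).
  exact: measurableT_comp.
transitivity (limn (fun n => \int[m]_z (h n (pi z) * p z)%:E)).
  have wE z : (w (pi z) * p z)%:E = limn (fun n => (h n (pi z) * p z)%:E).
    apply/esym/cvg_lim => //; rewrite EFinM; under eq_fun do rewrite EFinM.
    by apply: cvgeZr => //; exact: (cvg_nnsfun_approx measurableT mw w0').
  under eq_integral do rewrite wE.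
  apply: monotone_convergence => //.
  - by move=> n; apply/measurable_EFinP; exact: measurable_funM.
  - by move=> n z _; rewrite lee_fin mulr_ge0.
  - move=> z _ a b ab; rewrite lee_fin ler_wpM2r//.
    exact/lefP/(nd_nnsfun_approx measurableT mw).
congr (limn _); apply/funext => n /=; rewrite -/(h n).
have mA k : measurable (pi @^-1` (h n @^-1` [set k])).
  by rewrite -[X in measurable X]setTI; exact: mpi.
have m1 k : measurable_fun [set: S] (\1_(pi @^-1` (h n @^-1` [set k])) : S -> R).
  exact: measurable_indic.
have m1p k : measurable_fun setT
    (fun z => (\1_(pi @^-1` (h n @^-1` [set k])) z * p z)%R).
  exact: measurable_funM.
have p1 k z : (0 <= \1_(pi @^-1` (h n @^-1` [set k])) z * p z)%R.
  by rewrite mulr_ge0// indicE.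
transitivity (\int[m]_z \sum_(k \in range (h n))
    (k%:E * (\1_(pi @^-1` (h n @^-1` [set k])) z * p z)%:E)).
  apply: eq_integral => z _; rewrite fimfunE.
  transitivity ((\sum_(k \in range (h n)) (k * \1_(h n @^-1` [set k]) (pi z))%:E) * (p z)%:E).
    by rewrite fsumEFin // -EFinM.
  rewrite ge0_mule_fsuml; last by move=> k; exact: nnfun_muleindic_ge0.
  by apply: eq_fsbigr => k _; rewrite -!EFinM mulrA.
rewrite ge0_integral_fsum//; last 2 first.
- by move=> k; apply/measurable_EFinP; exact: measurable_funM.
- move=> k z _; rewrite -EFinM mulrA lee_fin mulr_ge0//.
  rewrite -lee_fin indicE -[_ \in _]/(pi z \in h n @^-1` [set k]) -indicE.
  exact: nnfun_muleindic_ge0.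
apply: eq_fsbigr => k; rewrite inE => -[x _ <-].
rewrite ge0_integralZl//; last 3 first.
- apply/measurable_EFinP; exact: m1p.
- by move=> z _; rewrite lee_fin.
- by rewrite lee_fin.
congr (_ * _); rewrite [RHS]integral_mkcond; apply: eq_integral => z _.
by rewrite /patch indicE; case: ifP => _; rewrite ?mul1r ?mul0r.
Qed.

(** Extends an identity tested on sets to one tested on nonnegative functions. It serves both the
    defining property of the regression function and that of a density. *)
Lemma integral_transfer d1 d2 (S1 : measurableType d1) (S2 : measurableType d2)
    (m1 : {measure set S1 -> \bar R}) (m2 : {measure set S2 -> \bar R})
    (pi1 : S1 -> X) (pi2 : S2 -> X) (p1 : S1 -> R) (p2 : S2 -> R) (w : X -> R) :
  measurable_fun [set: S1] pi1 -> measurable_fun [set: S2] pi2 ->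
  measurable_fun [set: S1] p1 -> measurable_fun [set: S2] p2 ->
  (forall z, 0 <= p1 z)%R -> (forall z, 0 <= p2 z)%R ->
  (forall B, measurable B ->
    \int[m1]_(z in pi1 @^-1` B) (p1 z)%:E = \int[m2]_(z in pi2 @^-1` B) (p2 z)%:E) ->
  measurable_fun [set: X] w -> (forall x, 0 <= w x)%R ->
  \int[m1]_z (w (pi1 z) * p1 z)%:E = \int[m2]_z (w (pi2 z) * p2 z)%:E.
Proof.
move=> mpi1 mpi2 mp1 mp2 p10 p20 H mw w0.
have mw' : measurable_fun [set: X] (EFin \o w) by exact/measurable_EFinP.
rewrite (integral_comp_approx m1 mw' mpi1 mp1 p10 w0).
rewrite (integral_comp_approx m2 mw' mpi2 mp2 p20 w0).
congr (limn _); apply/funext => n /=; apply: eq_fsbigr => k _.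
by rewrite H.
Qed.

End weighted_image.

Section clip.
Context (R : realType).

Definition clip (b t : R) : R := Num.max (- b) (Num.min b t).

Lemma clip_norm b t : 0 <= b -> `|clip b t| <= b.
Proof.
move=> b0; rewrite /clip ler_norml le_max lexx ge_max ge_min lexx/= andbT.
by rewrite (le_trans _ b0)// oppr_le0.
Qed.

Lemma clip_id b t : `|t| <= b -> clip b t = t.
Proof. by rewrite ler_norml /clip => /andP[? ?]; rewrite min_r// max_r. Qed.

Lemma clip_lip b u v : 0 <= b -> `|clip b u - clip b v| <= `|u - v|.
Proof.
move=> b0; wlog uv : u v / u <= v => [H|].
  by case: (leP u v) => [/H//|/ltW/H]; rewrite distrC [leRHS]distrC.
rewrite [leRHS]distrC [leLHS]distrC [leRHS]ger0_norm ?subr_ge0// ger0_norm; last first.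
  by rewrite subr_ge0 /clip le_max2// le_min2.
rewrite /clip; case: (leP b u) => bu; case: (leP b v) => bv;
  rewrite ?(max_r (_ : - b <= b)) ?le_max2 //; try lra;
  case: (leP (- b) u) => ?; case: (leP (- b) v) => ?; lra.
Qed.

Lemma measurable_clip b : measurable_fun [set: R] (clip b).
Proof.
apply: measurable_maxr; first exact: measurable_cst.
by apply: measurable_minr; [exact: measurable_cst|exact: measurable_id].
Qed.

End clip.

(** * Conditional mean identities and the decomposition of the risk *)

Section regression_identities.
Context (R : realType) d (X : measurableType d) (P : probability (X * R)%type R).
Context (fstar : X -> R).
Hypothesis hreg : is_regression P fstar.
Hypothesis mfs : measurable_fun [set: X] fstar.
Hypothesis fs1 : forall x, `|fstar x| <= 1.
Hypothesis hY : {ae P, forall z, `|z.2| <= 1}.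

Let PX := cov_law P.

Lemma Rint_cov_law (w : X -> R) : bmeas w -> \int[PX]_x w x = \int[P]_z w z.1.
Proof. by move=> bw; apply: (Rint_law _ _ bw) => //; exact: measurable_fst. Qed.

Lemma bmeas_clip_snd : bmeas (fun z : X * R => clip 1 z.2).
Proof.
split; first exact: measurableT_comp (measurable_clip 1) measurable_snd.
by exists 1 => z; exact: clip_norm.
Qed.

Lemma bmeas_fst (w : X -> R) : bmeas w -> bmeas (fun z : X * R => w z.1).
Proof. by move=> bw; apply: bmeas_comp bw _; exact: measurable_fst. Qed.

Let bfs : bmeas fstar. Proof. by split=> //; exists 1. Qed.

(** Adding 1 makes both integrands nonnegative, as [integral_transfer] demands; clipping alters the
    response on a null set only. *)
Let regression_set B : measurable B ->
  (\int[P]_(z in (@proj_cov _ X R) @^-1` B) (clip 1 z.2 + 1)%:E =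
   \int[PX]_(x in B) (fstar x + 1)%:E)%E.
Proof.
move=> mB; have [iy ifs H] := hreg.
have mpB : measurable ((@proj_cov _ X R) @^-1` B).
  by rewrite -[X in measurable X]setTI; exact: measurable_proj_cov.
under [LHS]eq_integral do rewrite EFinD.
under [RHS]eq_integral do rewrite EFinD.
rewrite integralD//=; last 2 first.
- by apply: integrableS (bmeas_integrable P bmeas_clip_snd).
- by apply: integrableS (bmeas_integrable P (bmeas_cst _ 1)).
rewrite integralD//=; last 2 first.
- by apply: integrableS (bmeas_integrable PX bfs).
- by apply: integrableS (bmeas_integrable PX (bmeas_cst _ 1)).
rewrite !integral_cst//; congr (_ + _)%E.
rewrite -H//; apply: ae_eq_integral => //.
- by apply/measurable_EFinP/measurable_funTS; case: bmeas_clip_snd.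
- by apply: measurable_funTS; apply: measurable_int iy.
- by apply: filterS hY => z z1 _ /=; rewrite clip_id.
Qed.

(** The transfer is applied to the response shifted by 1 and to nonnegative [w]; subtracting the
    integral of [w] removes the first shift, and adding a constant to [w] removes the sign
    condition. *)
Lemma Rint_regression (w : X -> R) : bmeas w ->
  \int[P]_z (clip 1 z.2 * w z.1) = \int[PX]_x (fstar x * w x).
Proof.
have ge0 v : bmeas v -> (forall x, 0 <= v x) ->
    \int[P]_z (v z.1 * (clip 1 z.2 + 1)) = \int[PX]_x (v x * (fstar x + 1)).
  move=> bv v0; congr fine.
  have mc : measurable_fun setT (fun z : X * R => clip 1 z.2 + 1).
    by case: (bmeasD bmeas_clip_snd (bmeas_cst _ 1)).
  have mf : measurable_fun setT (fun x => fstar x + 1).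
    by case: (bmeasD bfs (bmeas_cst _ 1)).
  have c0 (z : X * R) : 0 <= clip 1 z.2 + 1.
    by have := clip_norm z.2 ler01; rewrite ler_norml => /andP[? _]; lra.
  have f0 x : 0 <= fstar x + 1.
    by have := fs1 x; rewrite ler_norml => /andP[? _]; lra.
  have mid : measurable_fun [set: X] id by exact: measurable_id.
  exact: (@integral_transfer _ _ _ _ _ _ _ P PX _ id _ _ _
    (measurable_proj_cov (R := R)) mid mc mf c0 f0 regression_set bv.1 v0).
have ge0' v : bmeas v -> (forall x, 0 <= v x) ->
    \int[P]_z (clip 1 z.2 * v z.1) = \int[PX]_x (fstar x * v x).
  move=> bv v0; have := ge0 _ bv v0.
  rewrite (_ : \int[P]_z _ = \int[P]_z (clip 1 z.2 * v z.1 + v z.1)); last first.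
    by apply: eq_Rintegral => z _; ring.
  rewrite (_ : \int[PX]_x _ = \int[PX]_x (fstar x * v x + v x)); last first.
    by apply: eq_Rintegral => x _; ring.
  rewrite RintD; [|exact: bmeasM bmeas_clip_snd (bmeas_fst bv)|exact: bmeas_fst].
  rewrite RintD; [|exact: bmeasM bfs bv|by []].
  by rewrite (Rint_cov_law bv) => /addIr.
move=> bw; have [mw [M wM]] := bw; pose b := `|M|.
have bwb : bmeas (fun x => w x + b) by exact: bmeasD bw (bmeas_cst _ _).
have wb0 x : 0 <= w x + b.
  have := wM x; rewrite ler_norml => /andP[wx _]; have := ler_norm M.
  rewrite /b; lra.
have bb : bmeas (fun _ : X => b) by exact: bmeas_cst.
have := ge0' _ bwb wb0; have := ge0' _ bb (fun=> normr_ge0 M).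
rewrite (_ : \int[P]_z (clip 1 z.2 * (w z.1 + b)) =
    \int[P]_z (clip 1 z.2 * w z.1 + clip 1 z.2 * b)); last first.
  by apply: eq_Rintegral => z _; ring.
rewrite (_ : \int[PX]_x (fstar x * (w x + b)) =
    \int[PX]_x (fstar x * w x + fstar x * b)); last first.
  by apply: eq_Rintegral => x _; ring.
rewrite RintD; [|exact: bmeasM bmeas_clip_snd (bmeas_fst bw)
  |exact: bmeasM bmeas_clip_snd (bmeas_cst _ _)].
rewrite RintD; [|exact: bmeasM bfs bw|exact: bmeasM bfs bb].
by move=> -> /addIr.
Qed.

(** Noise plus squared distance to [fstar]: the residual is orthogonal to functions of the
    covariate, so the cross term vanishes. *)
Lemma riskE (f : X -> R) : bmeas f -> risk P f =
  (\int[P]_z (clip 1 z.2 - fstar z.1) ^+ 2 +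
   \int[PX]_x (f x - fstar x) ^+ 2)%:E.
Proof.
move=> bf; pose g x := f x - fstar x.
have bg : bmeas g by exact: bmeasB bf bfs.
have bc : bmeas (fun z : X * R => clip 1 z.2 - f z.1).
  exact: bmeasB bmeas_clip_snd (bmeas_fst bf).
have bcs : bmeas (fun z : X * R => clip 1 z.2 - fstar z.1).
  exact: bmeasB bmeas_clip_snd (bmeas_fst bfs).
have bsq d' (S : measurableType d') (h : S -> R) : bmeas h -> bmeas (fun z => h z ^+ 2).
  by move=> bh; under eq_fun do rewrite expr2; exact: bmeasM.
rewrite /risk unlock.
transitivity (\int[P]_z ((clip 1 z.2 - f z.1) ^+ 2)%:E)%E.
  apply: ae_eq_integral => //.
  - apply/measurable_EFinP; apply: measurable_funX; apply: measurable_funB => //.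
    exact: measurableT_comp bf.1 measurable_fst.
  - by apply/measurable_EFinP; case: (bsq _ _ _ bc).
  - by apply: filterS hY => z z1 _ /=; rewrite clip_id.
rewrite -(EFin_Rint P (bsq _ _ _ bc)); congr EFin.
have cross : \int[P]_z ((clip 1 z.2 - fstar z.1) * g z.1) = 0.
  rewrite (_ : \int[P]_z _ = \int[P]_z (clip 1 z.2 * g z.1 - fstar z.1 * g z.1)); last first.
    by apply: eq_Rintegral => z _; ring.
  rewrite RintB; [|exact: bmeasM bmeas_clip_snd (bmeas_fst bg)
    |exact: (bmeas_fst (bmeasM bfs bg))].
  by rewrite Rint_regression// (Rint_cov_law (bmeasM bfs bg)) subrr.
rewrite (_ : \int[P]_z _ = \int[P]_z ((clip 1 z.2 - fstar z.1) ^+ 2 +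
    ((- 2) * ((clip 1 z.2 - fstar z.1) * g z.1) + g z.1 ^+ 2))); last first.
  by apply: eq_Rintegral => z _; rewrite /g; ring.
have bcg : bmeas (fun z : X * R => (clip 1 z.2 - fstar z.1) * g z.1).
  exact: bmeasM bcs (bmeas_fst bg).
have bg2 := bmeas_fst (bsq _ _ _ bg).
rewrite RintD; [|exact: bsq|by apply: bmeasD => //; exact: bmeasZ].
rewrite RintD//; last exact: bmeasZ.
by rewrite RintZ// cross mulr0 add0r (Rint_cov_law (bsq _ _ _ bg)).
Qed.

Lemma excess_riskE (F : set (X -> R)) (f : X -> R) :
  (forall g, F g -> bmeas g) -> F fstar -> F f ->
  excess_risk P F f = (\int[PX]_x (f x - fstar x) ^+ 2)%:E.
Proof.
move=> bF Ffs Ff; rewrite /excess_risk.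
set c := \int[P]_z (clip 1 z.2 - fstar z.1) ^+ 2.
have sq0 g : 0 <= \int[PX]_x (g x - fstar x) ^+ 2.
  by apply: Rintegral_ge0 => x _; exact: sqr_ge0.
have -> : ereal_inf [set risk P g | g in F] = c%:E.
  have fsE : risk P fstar = c%:E.
    rewrite riskE// (_ : \int[PX]_x _ = 0) ?addr0// -[RHS](Rint_cst PX 0).
    by apply: eq_Rintegral => x _; rewrite subrr expr0n.
  apply/le_anti/andP; split; first by rewrite -fsE; apply: ereal_inf_lbound; exists fstar.
  apply: le_ereal_inf_tmp => _ [g Fg <-]; rewrite riskE; last exact: bF.
  by rewrite lee_fin lerDl.
by rewrite (riskE (bF _ Ff)) -EFinB addrC addKr.
Qed.

End regression_identities.

Lemma measurable_ratio (R : realType) d (X : measurableType d) (q p : X -> R) :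
  measurable_fun [set: X] q -> measurable_fun [set: X] p -> (forall x, 0 <= p x) ->
  measurable_fun [set: X] (fun x => q x / p x).
Proof.
(* On nonnegative reals the inverse is the power of exponent -1, both being 0 at 0. *)
move=> mq mp p0; under eq_fun do rewrite -powR_inv1//.
apply: measurable_funM => //.
exact: (measurableT_comp (measurable_powR (-1)) mp).
Qed.

Section change_of_measure.
Context (R : realType) d (X : measurableType d).
Context (mu : {measure set X -> \bar R}) (PX QX : probability X R) (p q : X -> R).
Hypothesis hp : has_density mu PX p.
Hypothesis hq : has_density mu QX q.
Hypothesis hpq : forall x, p x = 0 -> q x = 0.

Let rho := density_ratio p q.

Lemma density_ratio_ge0 x : 0 <= rho x.
Proof. by case: hp => _ p0 _; case: hq => _ q0 _; rewrite /rho divr_ge0. Qed.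

Lemma measurable_density_ratio : measurable_fun [set: X] rho.
Proof. by case: hp => mp p0 _; case: hq => mq _ _; exact: measurable_ratio. Qed.

Let density_integral (nu : probability X R) (r w : X -> R) : has_density mu nu r ->
  measurable_fun [set: X] w -> (forall x, 0 <= w x) ->
  (\int[nu]_x (w x)%:E = \int[mu]_x (w x * r x)%:E)%E.
Proof.
move=> [mr r0 hr] mw w0.
have mid : measurable_fun [set: X] id by exact: measurable_id.
have m1 : measurable_fun [set: X] (fun _ : X => 1 : R) by exact: measurable_cst.
rewrite -(@integral_transfer _ _ _ _ _ _ _ nu mu id id (fun=> 1) r w mid mid m1 mr)//.
  by under [RHS]eq_integral do rewrite mulr1.
by move=> B mB; rewrite integral_cst// mul1e; exact: hr.
Qed.

Lemma change_of_measure_ge0 (w : X -> R) :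
  measurable_fun [set: X] w -> (forall x, 0 <= w x) ->
  (\int[QX]_x (w x)%:E = \int[PX]_x (rho x * w x)%:E)%E.
Proof.
move=> mw w0; rewrite (density_integral hq)// (density_integral hp).
- apply: eq_integral => x _; rewrite /rho /density_ratio; congr EFin.
  (* Where the source density vanishes, finiteness of the ratio forces the target density to vanish
     as well. *)
  have [p0|p0] := eqVneq (p x) 0; first by rewrite p0 hpq// !mulr0.
  by field.
- by apply: measurable_funM => //; exact: measurable_density_ratio.
- by move=> x; rewrite mulr_ge0// density_ratio_ge0.
Qed.

(** [rho] may be unbounded; its integral under [PX] is the total mass of [QX]. *)
Lemma integrable_density_ratio : PX.-integrable setT (EFin \o rho).
Proof.
apply/integrableP; split; first exact/measurable_EFinP/measurable_density_ratio.
under eq_integral do rewrite /= ger0_norm ?density_ratio_ge0//.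
have := @change_of_measure_ge0 (fun=> 1) (measurable_cst _) (fun=> ler01).
under [in RHS]eq_integral do rewrite mulr1; move=> <-.
by rewrite integral_cst// mul1e [X in (X < _)%E]probability_setT ltry.
Qed.

Lemma integrable_density_ratioM (w : X -> R) : bmeas w ->
  PX.-integrable setT (EFin \o (fun x => rho x * w x)).
Proof.
move=> [mw [M wM]].
apply: (@le_integrable _ _ _ PX _ measurableT _ (EFin \o (fun x => `|M| * rho x))).
- apply/measurable_EFinP; apply: measurable_funM => //; exact: measurable_density_ratio.
- move=> x _ /=; rewrite lee_fin !normrM mulrC normr_id ler_wpM2r//.
  exact: le_trans (wM x) (ler_norm _).
- exact: (integrableZl measurableT `|M| integrable_density_ratio).
Qed.

Lemma change_of_measure (w : X -> R) : bmeas w ->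
  \int[QX]_x w x = \int[PX]_x (rho x * w x).
Proof.
have ge0 v : bmeas v -> (forall x, 0 <= v x) ->
    \int[QX]_x v x = \int[PX]_x (rho x * v x).
  by move=> bv v0; congr fine; apply: change_of_measure_ge0 => //; exact: bv.1.
move=> bw; have [mw [M wM]] := bw; pose b := `|M|.
have bb : bmeas (fun _ : X => b) by exact: bmeas_cst.
have bwb : bmeas (fun x => w x + b) by exact: bmeasD.
have wb0 x : 0 <= w x + b.
  have := wM x; rewrite ler_norml => /andP[wx _]; have := ler_norm M.
  rewrite /b; lra.
have := ge0 _ bwb wb0; rewrite RintD// (ge0 _ bb (fun=> normr_ge0 M)).
rewrite (_ : \int[PX]_x (rho x * (w x + b)) =
    \int[PX]_x (rho x * w x + rho x * b)); last first.
  by apply: eq_Rintegral => x _; rewrite mulrDr.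
rewrite RintegralD//; [by move/addIr|exact: integrable_density_ratioM..].
Qed.

(** Cauchy-Schwarz on the two pilot errors; 4 is the leading 2 times the bound 2 on [g]. *)
Lemma doubly_robust_bias (rhohat h g : X -> R) :
  bmeas rhohat -> bmeas h -> bmeas g -> (forall x, `|g x| <= 2) ->
  ((2 * `|\int[PX]_x ((rhohat x - rho x) * h x * g x)|)%:E <=
    4%:E * (L2norm PX (fun x => (rhohat x - rho x)%R) * L2norm PX h))%E.
Proof.
move=> br bh bg g2.
have md : measurable_fun [set: X] (fun x => rhohat x - rho x).
  by apply: measurable_funB; [exact: br.1|exact: measurable_density_ratio].
have mdh : measurable_fun [set: X] (fun x => (rhohat x - rho x) * h x).
  by apply: measurable_funM => //; exact: bh.1.
have mdhg : measurable_fun [set: X] (fun x => (rhohat x - rho x) * h x * g x).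
  by apply: measurable_funM => //; exact: bg.1.
(* With [rho] merely integrable, the integrand is split into a bounded function minus [rho] times a
   bounded function. *)
have ii : PX.-integrable setT (EFin \o (fun x => (rhohat x - rho x) * h x * g x)).
  rewrite (_ : _ \o _ = (EFin \o (fun x => rhohat x * (h x * g x))%R) \-
      (EFin \o (fun x => rho x * (h x * g x))%R))%E.
    apply: integrableB => //.
      by apply: bmeas_integrable; apply: bmeasM br _; exact: bmeasM bh bg.
    by apply: integrable_density_ratioM; exact: bmeasM.
  by apply/funext => x /=; rewrite -EFinB; congr EFin; ring.
have H := @hoelder _ _ _ PX (fun x => rhohat x - rho x) h 2 2 md bh.1
  (ltr0n _ 2) (ltr0n _ 2) _.
rewrite /L2norm (_ : 4 = 2 * 2)%R; last by ring.
rewrite !EFinM -muleA; apply: lee_wpmul2l; first by rewrite lee_fin.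
apply: (@le_trans _ _ (2%:E *
    'N[PX]_1[EFin \o ((fun x => rhohat x - rho x) \* h)%R])%E); last first.
  by apply: lee_wpmul2l; [rewrite lee_fin|apply: H; field].
rewrite EFin_normr_Rintegral// Lnorm1 -ge0_integralZl//; last first.
  by apply: measurableT_comp => //; apply/measurable_EFinP; exact: mdh.
apply: (le_trans (le_abse_integral _ _ _)) => //; first exact/measurable_EFinP.
apply: ge0_le_integral => //=.
- by apply/measurable_EFinP; apply: measurableT_comp => //; exact: mdhg.
- by apply: measurable_funeM; apply/measurable_EFinP; apply: measurableT_comp => //; exact: mdh.
- move=> x _; rewrite -EFinM lee_fin normrM mulrC ler_wpM2r//.
Qed.

End change_of_measure.

(** * The doubly robust losses *)

Lemma sup_norm_le (R : realType) d (X : measurableType d) (f : X -> R) (M : R) :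
  (sup_norm f <= M%:E)%E -> forall x, `|f x| <= M.
Proof.
move=> fM x; rewrite -lee_fin; apply: le_trans fM.
by apply: ereal_sup_ubound; exists x.
Qed.

Lemma probability_setI_ge (R : realType) d (T : measurableType d)
    (mu : probability T R) (A B : set T) (a b : R) :
  measurable A -> measurable B ->
  ((1 - a)%:E <= mu A)%E -> ((1 - b)%:E <= mu B)%E ->
  ((1 - (a + b))%:E <= mu (A `&` B))%E.
Proof.
move=> mA mB hA hB.
have cA C (c : R) : measurable C -> ((1 - c)%:E <= mu C)%E -> (mu (~` C) <= c%:E)%E.
  move=> mC; rewrite probability_setC// -(fineK (fin_num_measure mu _ mC)).
  by rewrite -EFinB !lee_fin => ?; lra.
have mI := measurableI _ _ mA mB.
rewrite -[A `&` B]setCK probability_setC; last exact: measurableC.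
have : (mu (~` (A `&` B)) <= (a + b)%:E)%E.
  rewrite setCI EFinD; apply: (le_trans (measureU2 mu (measurableC mA) (measurableC mB))).
  by apply: leeD; exact: cA.
rewrite -(fineK (fin_num_measure mu _ (measurableC mI))) -EFinB !lee_fin => ?; lra.
Qed.

Section doubly_robust_losses.
Context (R : realType) d (X : measurableType d).
Context (rhohat fhat0 fstar : X -> R) (Cdr Crf : R).
Hypothesis mrho : measurable_fun [set: X] rhohat.
Hypothesis mf0 : measurable_fun [set: X] fhat0.
Hypothesis mfs : measurable_fun [set: X] fstar.
Hypothesis Cdr0 : 0 < Cdr.
Hypothesis Crf0 : 0 < Crf.
Hypothesis rho_b : forall x, `|rhohat x| <= Cdr.
Hypothesis f0_b : forall x, `|fhat0 x| <= Crf.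
Hypothesis fs_b : forall x, `|fstar x| <= 1.

(* The increments of the two parts of the empirical risk between [fstar] and
   [fstar + t]; clipping is inactive on the relevant range and makes the losses
   bounded and Lipschitz everywhere. *)
Definition source_loss (z : X * R) (t : R) : R :=
  - 2 * (rhohat z.1 * (clip 1 z.2 - fhat0 z.1)) * t.

Definition target_loss (x : X) (t : R) : R :=
  clip 2 t ^+ 2 + 2 * (clip 2 t * (fstar x - fhat0 x)).

Lemma measurable_source_loss :
  measurable_fun setT (fun w : (X * R) * R => source_loss w.1 w.2).
Proof.
have m11 : measurable_fun setT (fun w : (X * R) * R => w.1.1).
  exact: measurableT_comp measurable_fst measurable_fst.
have m12 : measurable_fun setT (fun w : (X * R) * R => w.1.2).
  exact: measurableT_comp measurable_snd measurable_fst.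
apply: measurable_funM => //; apply: measurable_funM; first exact: measurable_cst.
apply: measurable_funM; first exact: measurableT_comp mrho m11.
apply: measurable_funB; first exact: measurableT_comp (measurable_clip 1) m12.
exact: measurableT_comp mf0 m11.
Qed.

Lemma measurable_target_loss :
  measurable_fun setT (fun w : X * R => target_loss w.1 w.2).
Proof.
have mc : measurable_fun setT (fun w : X * R => clip 2 w.2).
  exact: measurableT_comp (measurable_clip 2) measurable_snd.
apply: measurable_funD; first exact: measurable_funX.
apply: measurable_funM; first exact: measurable_cst.
apply: measurable_funM => //; apply: measurable_funB.
  exact: measurableT_comp mfs measurable_fst.
exact: measurableT_comp mf0 measurable_fst.
Qed.

Let weight_b z : `|rhohat z.1 * (clip 1 z.2 - fhat0 z.1)| <= Cdr * (1 + Crf).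
Proof.
rewrite normrM; apply: ler_pM => //; apply: (le_trans (ler_normB _ _)).
by apply: lerD => //; exact: clip_norm.
Qed.

Lemma source_loss_lip z u v :
  `|source_loss z u - source_loss z v| <= 2 * Cdr * (1 + Crf) * `|u - v|.
Proof.
rewrite /source_loss -mulrBr normrM ler_wpM2r// normrM normrN [`|2|]ger0_norm//.
by rewrite -mulrA ler_wpM2l// weight_b.
Qed.

Lemma source_loss_bound z t : `|t| <= 2 -> `|source_loss z t| <= 4 * Cdr * (1 + Crf).
Proof.
move=> t2; have := source_loss_lip z t 0.
rewrite {2}/source_loss mulr0 !subr0 => /le_trans; apply.
rewrite (_ : 4 * _ * _ = 2 * Cdr * (1 + Crf) * 2); last by ring.
by rewrite ler_wpM2l// !mulr_ge0 ?(ltW Cdr0)// addr_ge0// ltW.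
Qed.

Lemma target_loss0 x : target_loss x 0 = 0.
Proof. by rewrite /target_loss clip_id ?normr0//; ring. Qed.

Lemma source_loss0 z : source_loss z 0 = 0.
Proof. by rewrite /source_loss mulr0. Qed.

Let two_ge0 : 0 <= 2 :> R. Proof. by []. Qed.

(** The difference factors through [clip 2 u - clip 2 v]; the cofactor is at most
    [2 + 2 + 2 * (1 + Crf)]. *)
Lemma target_loss_lip x u v :
  `|target_loss x u - target_loss x v| <= 2 * (3 + Crf) * `|u - v|.
Proof.
rewrite (_ : _ - _ = (clip 2 u + clip 2 v + 2 * (fstar x - fhat0 x)) *
    (clip 2 u - clip 2 v)); last by rewrite /target_loss; ring.
rewrite normrM; apply: ler_pM => //; last exact: clip_lip.
have := clip_norm u two_ge0; have := clip_norm v two_ge0.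
have := fs_b x; have := f0_b x; rewrite !ler_norml.
by move=> /andP[? ?] /andP[? ?] /andP[? ?] /andP[? ?]; lra.
Qed.

(** The factorisation [(f - fstar) * (f + fstar - 2 * fhat0)] uses [f] itself to be bounded by 1 and
    gives [2 * (2 + 2 * Crf)], sharper than the Lipschitz bound on the increment. *)
Lemma target_loss_bound x f : `|f| <= 1 ->
  `|target_loss x (f - fstar x)| <= 4 * (1 + Crf).
Proof.
move=> f1; have fs1 := fs_b x; have f01 := f0_b x.
have d2 : `|f - fstar x| <= 2.
  by apply: (le_trans (ler_normB _ _)); rewrite (_ : 2 = 1 + 1)%R ?lerD//.
rewrite /target_loss clip_id//.
rewrite (_ : _ + _ = (f - fstar x) * (f + fstar x - 2 * fhat0 x)); last by ring.
rewrite normrM (_ : 4 * _ = 2 * (2 * (1 + Crf))); last by ring.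
apply: ler_pM => //; move: f1 fs1 f01; rewrite !ler_norml.
by move=> /andP[? ?] /andP[? ?] /andP[? ?]; lra.
Qed.

(** Each source summand is affine in the value of [f], hence the linear [source_loss]; each target
    summand is a square expanded around [fstar]. *)
Lemma dr_riskB nP nQ (D : nP.-tuple (X * R) * nQ.-tuple X) (f : X -> R) :
  (forall x, `|f x| <= 1) -> (forall i, `|(tnth D.1 i).2| <= 1) ->
  dr_risk rhohat fhat0 D f - dr_risk rhohat fhat0 D fstar =
  nP%:R^-1 * (\sum_(i < nP) source_loss (tnth D.1 i)
                (f (tnth D.1 i).1 - fstar (tnth D.1 i).1)) +
  nQ%:R^-1 * (\sum_(j < nQ) target_loss (tnth D.2 j)
                (f (tnth D.2 j) - fstar (tnth D.2 j))).
Proof.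
move=> f1 Y1; rewrite /dr_risk opprD addrACA -!mulrBr; congr (_ * _ + _ * _).
  rewrite -sumrB; apply: eq_bigr => i _; have := Y1 i.
  case: (tnth D.1 i) => x y /= y1; rewrite /source_loss/= clip_id//; ring.
rewrite -sumrB; apply: eq_bigr => j _; set x := tnth D.2 j.
have d2 : `|f x - fstar x| <= 2.
  by apply: (le_trans (ler_normB _ _)); rewrite (_ : 2 = 1 + 1)%R ?lerD//.
by rewrite /target_loss clip_id//; ring.
Qed.

Context (P Q : probability (X * R)%type R).
Context (mu : {measure set X -> \bar R}) (p q : X -> R).
Hypothesis hp : has_density mu (cov_law P) p.
Hypothesis hq : has_density mu (cov_law Q) q.
Hypothesis hpq : forall x, p x = 0 -> q x = 0.
Hypothesis hreg : is_regression P fstar.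
Hypothesis hY : {ae P, forall z, `|z.2| <= 1}.

(** Double robustness: under the source, conditioning replaces the response by [fstar]; under the
    target, change of measure turns the cross term into a source integral weighted by the true
    ratio. The two terms combine into a product of pilot errors. *)
Lemma population_loss (f : X -> R) :
  measurable_fun [set: X] f -> (forall x, `|f x| <= 1) ->
  \int[P]_z source_loss z (f z.1 - fstar z.1) +
  \int[cov_law Q]_x target_loss x (f x - fstar x) =
  \int[cov_law Q]_x (f x - fstar x) ^+ 2 +
  2 * \int[cov_law P]_x ((rhohat x - density_ratio p q x) * (fhat0 x - fstar x) *
                         (f x - fstar x)).
Proof.
move=> mf f1; pose g x := f x - fstar x.
have brho : bmeas rhohat by split=> //; exists Cdr.
have bf0 : bmeas fhat0 by split=> //; exists Crf.
have bfs : bmeas fstar by split=> //; exists 1.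
have bf : bmeas f by split=> //; exists 1.
have bg : bmeas g by exact: bmeasB.
have bh : bmeas (fun x => fhat0 x - fstar x) by exact: bmeasB.
have g2 x : `|g x| <= 2.
  by apply: (le_trans (ler_normB _ _)); rewrite (_ : 2 = 1 + 1)%R ?lerD//.
have brg : bmeas (fun x => rhohat x * g x) by exact: bmeasM.
have bhg : bmeas (fun x => (fhat0 x - fstar x) * g x) by exact: bmeasM.
have brhg : bmeas (fun x => rhohat x * ((fhat0 x - fstar x) * g x)) by exact: bmeasM.
have srcE : \int[P]_z source_loss z (f z.1 - fstar z.1) =
    2 * \int[cov_law P]_x (rhohat x * ((fhat0 x - fstar x) * g x)).
  rewrite (_ : \int[P]_z _ = \int[P]_z (2 * (fhat0 z.1 * (rhohat z.1 * g z.1) -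
      clip 1 z.2 * (rhohat z.1 * g z.1)))); last first.
    by apply: eq_Rintegral => z _; rewrite /source_loss /g; ring.
  have b1 : bmeas (fun z : X * R => fhat0 z.1 * (rhohat z.1 * g z.1)).
    by apply: (bmeas_fst (w := fun x => fhat0 x * (rhohat x * g x))); exact: bmeasM.
  have b2 : bmeas (fun z : X * R => clip 1 z.2 * (rhohat z.1 * g z.1)).
    by apply: bmeasM (bmeas_fst brg); exact: bmeas_clip_snd.
  rewrite RintZ; last exact: bmeasB.
  rewrite RintB// (Rint_regression hreg mfs fs_b hY brg).
  rewrite -(Rint_cov_law P (w := fun x => fhat0 x * (rhohat x * g x))); last exact: bmeasM.
  rewrite -RintB; [|exact: bmeasM|exact: bmeasM].
  by congr (_ * _); apply: eq_Rintegral => x _; ring.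
have tgtE : \int[cov_law Q]_x target_loss x (f x - fstar x) =
    \int[cov_law Q]_x (f x - fstar x) ^+ 2 -
    2 * \int[cov_law P]_x (density_ratio p q x * ((fhat0 x - fstar x) * g x)).
  rewrite -(change_of_measure hp hq hpq bhg) -RintZ//.
  rewrite -RintB; last exact: bmeasZ.
    apply: eq_Rintegral => x _.
    by rewrite /target_loss clip_id; [rewrite /g; ring|exact: g2].
  by under eq_fun do rewrite expr2; exact: (bmeasM bg bg).
rewrite srcE tgtE addrC -addrA; congr (_ + _).
rewrite addrC -mulrBr -RintegralB//.
- by congr (_ * _); apply: eq_Rintegral => x _; rewrite /g; ring.
- exact: bmeas_integrable.
- exact: (integrable_density_ratioM hp hq hpq bhg).
Qed.

End doubly_robust_losses.

(** * Assembly of the final bound *)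

(** [a], [b] stand for the population losses, [ea], [eb] for the empirical ones, [bi] for the bias
    integral and [A], [B] for the uniform deviation bounds. *)
Lemma excess_le_bias_deviation (R : realFieldType) (EQ a b ea eb bi A B : R) :
  a + b = EQ + 2 * bi -> ea + eb <= 0 -> a - ea <= A -> b - eb <= B ->
  EQ <= 2 * `|bi| + (A + B).
Proof.
by move=> h1 h2 h3 h4; have := ler_norm (- bi); rewrite normrN => h5; lra.
Qed.

(** Here [s] and [sL] stand for the square roots of [2 * L] and [L]. The gap between the two sides
    is an explicit sum of nonnegative products. *)
Lemma deviation_terms_le (R : realFieldType) (Cdr Crf e s sL sP sQ rP rQ : R) :
  0 < Cdr -> 0 < Crf -> 0 <= s -> 0 <= sL -> 0 < sP -> 0 < sQ ->
  0 <= rP -> 0 <= rQ ->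
  (2 * (2 * Cdr * (1 + Crf)) * rP + e + 4 * Cdr * (1 + Crf) * s / sP) +
  (2 * (2 * (3 + Crf)) * rQ + e + 4 * (1 + Crf) * s / sQ) <=
  2 * e + 4 * (1 + Cdr) * (2 + Crf) * s * (1 / sP + 1 / sQ) +
  8 * (1 + Cdr) * (2 + Crf) * sL * (rP * sP^-1 + rQ * sQ^-1) +
  8 * Cdr * (1 + Crf) * rP + 8 * (3 + Crf) * rQ.
Proof.
move=> d0 f0 s0 sL0 sP0 sQ0 rP0 rQ0.
have C : 0 <= Cdr * Crf by rewrite mulr_ge0// ltW.
have hP : 0 <= (8 + 4 * Cdr + 4 * Crf) * (s / sP).
  by rewrite mulr_ge0 ?divr_ge0 ?(ltW sP0)//; lra.
have hQ : 0 <= (4 + 8 * Cdr + 4 * (Cdr * Crf)) * (s / sQ).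
  by rewrite mulr_ge0 ?divr_ge0 ?(ltW sQ0)//; lra.
have hm : 0 <= 8 * (1 + Cdr) * (2 + Crf) * sL * (rP * sP^-1 + rQ * sQ^-1).
  apply: mulr_ge0; first by rewrite !mulr_ge0//; lra.
  by rewrite addr_ge0// mulr_ge0// invr_ge0 ltW.
have hr : 0 <= (4 * Cdr + 4 * (Cdr * Crf)) * rP by rewrite mulr_ge0//; lra.
have hq : 0 <= (12 + 4 * Crf) * rQ by rewrite mulr_ge0//; lra.
rewrite -subr_ge0 (_ : _ - _ = (8 + 4 * Cdr + 4 * Crf) * (s / sP) +
  (4 + 8 * Cdr + 4 * (Cdr * Crf)) * (s / sQ) +
  8 * (1 + Cdr) * (2 + Crf) * sL * (rP * sP^-1 + rQ * sQ^-1) +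
  (4 * Cdr + 4 * (Cdr * Crf)) * rP + (12 + 4 * Crf) * rQ); last by ring.
by rewrite !addr_ge0.
Qed.

(** [B] stays extended because it stands for the product of L2 norms, which may be infinite. *)
Lemma ereal_sum_EFin (R : realType) (B : \bar R) (a b m u v w k x l : R) :
  (B + a%:E + b%:E + m%:E * (u%:E * v%:E + w%:E * x%:E) + k%:E * u%:E + l%:E * w%:E =
   B + (a + b + m * (u * v + w * x) + k * u + l * w)%:E)%E.
Proof. by rewrite !(EFinD, EFinM) !addeA. Qed.

Unset Implicit Arguments.
Set Strict Implicit.
Set Printing Implicit Defensive.

(** [fDR] is an arbitrary selection of minimisers, so the displayed set may fail to be measurable;
    the proof exhibits a measurable event inside it. *)
Theorem theorem4p1
  (R : realType) (d : measure_display) (X : measurableType d)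
  (P Q : probability (X * R)%type R)
  (muX : {sigma_finite_measure set X -> \bar R}) (pX qX : X -> R)
  (hpX : has_density muX (cov_law P) pX)
  (hqX : has_density muX (cov_law Q) qX)
  (hrho_fin : forall x, pX x = 0 -> qX x = 0)
  (F : set (X -> R)) (hFmeas : forall f, F f -> measurable_fun [set: X] f)
  (fstar : X -> R)
  (hregP : is_regression P fstar) (hregQ : is_regression Q fstar)
  (hfstar : F fstar)
  (hF1 : (ereal_sup [set sup_norm f | f in F] <= 1)%E)
  (hYP : {ae P, forall z, `|z.2| <= 1}) (hYQ : {ae Q, forall z, `|z.2| <= 1})
  (rhohat fhat0 : X -> R)
  (hrhomeas : measurable_fun [set: X] rhohat)
  (hf0meas : measurable_fun [set: X] fhat0)
  (hrho0 : forall x, 0 <= rhohat x)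
  (Cdr Crf : R) (hCdr : 0 < Cdr) (hCrf : 0 < Crf)
  (hrhob : (sup_norm rhohat <= Cdr%:E)%E) (hf0b : (sup_norm fhat0 <= Crf%:E)%E)
  (nP nQ : nat) (hnP : (0 < nP)%N) (hnQ : (0 < nQ)%N)
  (fDR : nP.-tuple (X * R) * nQ.-tuple X -> X -> R)
  (hfDR : {ae data_law nP nQ P Q, forall D,
    is_argmin F (dr_risk rhohat fhat0 D) (fDR D)})
  (delta : R) (hdelta : 0 < delta < 1) :
  let PX := cov_law P in
  let QX := cov_law Q in
  let rhostar := density_ratio pX qX in
  let RadP := rademacher PX nP (shifted_class F fstar) in
  let RadQ := rademacher QX nQ (shifted_class F fstar) in
  let L := ln (3 / delta) in
  let sP : R := Num.sqrt nP%:R in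
  let sQ : R := Num.sqrt nQ%:R in
  with_prob_ge (data_law nP nQ P Q) (1 - delta) [set D |
    (excess_risk Q F (fDR D) = 'E_QX[fun x => ((fDR D x - fstar x) ^+ 2)%R])%E /\
    ('E_QX[fun x => ((fDR D x - fstar x) ^+ 2)%R] <=
      4%:E * (L2norm PX (fun x => (rhohat x - rhostar x)%R)
              * L2norm PX (fun x => (fhat0 x - fstar x)%R))
      + (12 * (2 + Crf) * L * (Cdr / nP%:R + 1 / nQ%:R))%:E
      + (4 * (1 + Cdr) * (2 + Crf) * Num.sqrt (2 * L) * (1 / sP + 1 / sQ))%:E
      + (8 * (1 + Cdr) * (2 + Crf) * Num.sqrt L)%:E
        * (RadP * (sP^-1)%:E + RadQ * (sQ^-1)%:E)
      + (8 * Cdr * (1 + Crf))%:E * RadP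
      + (8 * (3 + Crf))%:E * RadQ)%E].
Proof.
move=> PX QX rhostar RadP RadQ L sP sQ.
have F1 f : F f -> forall x, `|f x| <= 1.
  move=> Ff; apply: sup_norm_le; apply: le_trans hF1.
  by apply: ereal_sup_ubound; exists f.
have rho_b := sup_norm_le hrhob; have f0_b := sup_norm_le hf0b.
have fs_b := F1 _ hfstar; have mfs := hFmeas _ hfstar.
have bF f : F f -> bmeas f by move=> Ff; split; [exact: hFmeas|exists 1; exact: F1].
have [delta0 delta1] := andP hdelta.
pose G := shifted_class F fstar.
have Gg0 : G (fun x => fstar x - fstar x) by exists fstar.
have mG g : G g -> measurable_fun setT g.
  by move=> [f Ff <-]; apply: measurable_funB => //; exact: hFmeas.
have Gb g x : G g -> `|g x| <= 2.
  move=> [f Ff <-]; apply: (le_trans (ler_normB _ _)).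
  by rewrite (_ : 2 = 1 + 1)%R// lerD// F1.
have nPR : 0 < nP%:R :> R by rewrite ltr0n.
have nQR : 0 < nQ%:R :> R by rewrite ltr0n.
have L0 : 0 < L by rewrite ln_gt0// ltr_pdivlMr// mul1r; lra.
(* Half of the term with [Cdr / nP] and [1 / nQ]: the slack granted to each of the two processes. *)
pose e := 6 * (2 + Crf) * L * (Cdr / nP%:R + 1 / nQ%:R).
have e0 : 0 < e.
  by rewrite /e !mulr_gt0//; [lra|rewrite addr_gt0// divr_gt0].
have eta01 : 0 < delta / 3 < 1 by apply/andP; split; lra.
have LE : ln ((delta / 3)^-1) = L by rewrite invf_div.
have C1 : 0 < 1 + Crf by lra.
have LP0 : 0 < 2 * Cdr * (1 + Crf) by rewrite !mulr_gt0.
have KP0 : 0 < 4 * Cdr * (1 + Crf) by rewrite !mulr_gt0.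
have LQ0 : 0 < 2 * (3 + Crf) by lra.
have KQ0 : 0 < 4 * (1 + Crf) by lra.
have [AP [mAP PAP HAP]] := uniform_deviation (mu := P) (nu := PX)
  measurable_fst (fun _ _ => erefl) Gg0 mG Gb LP0 KP0
  (measurable_source_loss hrhomeas hf0meas)
  (source_loss_lip rho_b f0_b) (source_loss0 rhohat fhat0)
  (fun z g Gg => source_loss_bound hCdr hCrf rho_b f0_b z (Gb g z.1 Gg))
  hnP e0 eta01.
have tb x g : G g -> `|target_loss fhat0 fstar x (g x)| <= 4 * (1 + Crf).
  by move=> [f Ff <-]; apply: target_loss_bound => //; exact: F1.
have mid : measurable_fun [set: X] id by exact: measurable_id.
have [AQ [mAQ PAQ HAQ]] := uniform_deviation (mu := QX) (nu := QX) (pi := id)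
  mid (fun _ _ => erefl) Gg0 mG Gb LQ0 KQ0
  (measurable_target_loss hf0meas mfs)
  (target_loss_lip f0_b fs_b) (target_loss0 fhat0 fstar) tb
  hnQ e0 eta01.
have [NY [mNY NY0 NYP]] := hYP.
have [N [mN N0 NP]] := hfDR.
(* The almost sure bound on the response becomes a full-measure event for the whole source sample,
   on which clipping is inactive. *)
pose AY := box (fun _ : 'I_nP => ~` NY).
have mAY : measurable AY by apply: measurable_box => _; exact: measurableC.
have PAY : ((1 - 0)%:E <= iid_law P nP AY)%E.
  rewrite subr0 iid_law_box; last by move=> _; exact: measurableC.
  by rewrite big1// => _ _; rewrite probability_setC// NY0 sube0.
have PA1 := probability_setI_ge mAP mAY PAP PAY.
have mA1 := measurableI _ _ mAP mAY.
pose mu : probability _ R := data_law nP nQ P Q.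
have PX1 : ((1 - (delta / 3 + 0))%:E <= mu ((AP `&` AY) `*` setT))%E.
  apply: le_trans PA1 _.
  by rewrite [leRHS]product_measure1E// [X in (_ * X)%E]probability_setT mule1.
have PX2 : ((1 - delta / 3)%:E <= mu (setT `*` AQ))%E.
  apply: le_trans PAQ _.
  by rewrite [leRHS]product_measure1E// [X in (X * _)%E]probability_setT mul1e.
have mX1 : measurable ((AP `&` AY) `*` [set: nQ.-tuple X]) by exact: measurableX.
have mX2 : measurable ([set: nP.-tuple (X * R)] `*` AQ) by exact: measurableX.
have PN : ((1 - 0)%:E <= mu (~` N))%E.
  by rewrite probability_setC// [X in (_ - X)%E]N0 sube0 subr0.
have PX12 := probability_setI_ge mX1 mX2 PX1 PX2.
have PA := probability_setI_ge (measurableI _ _ mX1 mX2) (measurableC mN) PX12 PN.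
(* Only the two deviation events cost probability, [delta / 3] each; the events for the responses
   and for the minimiser have full measure. *)
eexists; split; [|move=> D|apply: le_trans PA; rewrite lee_fin; lra].
  by apply: measurableI; [exact: measurableI|exact: measurableC].
move=> [[[[APD AYD] _] [_ AQD]] ND].
have [Ff Jmin] : is_argmin F (dr_risk rhohat fhat0 D) (fDR D).
  by apply: contrapT => H; apply: ND; exact: NP.
have Y1 i : `|(tnth D.1 i).2| <= 1.
  by apply: contrapT => H; apply: (AYD i); exact: NYP.
set f := fDR D in Ff Jmin *.
have EQE : ('E_QX[fun x => ((f x - fstar x) ^+ 2)%R] =
    (\int[QX]_x ((f x - fstar x) ^+ 2)%R)%R%:E)%E.
  rewrite unlock -EFin_Rint//; under eq_fun do rewrite expr2.
  by have bg := bmeasB (bF _ Ff) (bF _ hfstar); exact: (bmeasM bg bg).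
split; first by rewrite EQE (excess_riskE hregQ mfs fs_b hYQ bF hfstar Ff).
pose bias := 2 * `|\int[PX]_x ((rhohat x - rhostar x) * (fhat0 x - fstar x) *
                               (f x - fstar x))|.
have Gf : G (fun x => f x - fstar x) by exists f.
have biasE : (bias%:E <= 4%:E * (L2norm PX (fun x => (rhohat x - rhostar x)%R)
              * L2norm PX (fun x => (fhat0 x - fstar x)%R)))%E.
  apply: (doubly_robust_bias hpX hqX hrho_fin).
  - by split=> //; exists Cdr.
  - by apply: bmeasB (bF _ hfstar); split=> //; exists Crf.
  - exact: bmeasB (bF _ Ff) (bF _ hfstar).
  - by move=> x; exact: (Gb _ x Gf).
have RPE : RadP = (fine RadP)%:E by rewrite [RadP](rademacherE PX Gg0 Gb hnP).
have RQE : RadQ = (fine RadQ)%:E by rewrite [RadQ](rademacherE QX Gg0 Gb hnQ).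
have RP0 : 0 <= fine RadP by exact: (rademacher_ge0 PX Gg0 Gb hnP).
have RQ0 : 0 <= fine RadQ by exact: (rademacher_ge0 QX Gg0 Gb hnQ).
have devP := HAP D.1 _ APD Gf; have devQ := HAQ D.2 _ AQD Gf.
rewrite LE -/G -/RadP -/sP in devP; rewrite LE -/G -/RadQ -/sQ in devQ.
have emp : dr_risk rhohat fhat0 D f - dr_risk rhohat fhat0 D fstar <= 0.
  by rewrite subr_le0; exact: Jmin.
rewrite (dr_riskB rhohat fhat0 fs_b (F1 _ Ff) Y1) in emp.
have pop := population_loss hrhomeas hf0meas mfs rho_b f0_b fs_b hpX hqX hrho_fin
  hregP hYP (hFmeas _ Ff) (F1 _ Ff).
rewrite -/PX -/QX -/rhostar in pop.
rewrite EQE RPE RQE; set rP := fine RadP in RP0 devP *; set rQ := fine RadQ in RQ0 devQ *.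
have sP0 : 0 < sP by rewrite sqrtr_gt0.
have sQ0 : 0 < sQ by rewrite sqrtr_gt0.
rewrite ereal_sum_EFin (_ : 12 * _ * _ * _ = 2 * e); last by rewrite /e; ring.
apply: le_trans (leeD2r _ biasE); rewrite -EFinD lee_fin.
apply: le_trans (excess_le_bias_deviation pop emp devP devQ) _.
rewrite lerD2l; apply: deviation_terms_le hCdr hCrf _ _ sP0 sQ0 RP0 RQ0;
  exact: sqrtr_ge0.
Qed.
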